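(* Let $n\ge2$. There exists a bijection $\Xi$ from the set of subsets of $\Phi^+$ to the set of lowest weight elements of $\mathrm{SDT}(-\infty)$. Furthermore, $\Xi$ is weight preserving: for $B=\{\beta_1,\dots,\beta_k\}\subseteq\Phi^+$, we have $\mathrm{wt}(\Xi(B))=\beta_1+\cdots+\beta_k$.
   Context: $I_0=\{1,\dots,n-1\}$, $I=I_0\sqcup\{\overline1\}$; $\epsilon_1,\dots,\epsilon_n$ is the standard basis of $\mathbb Z^n$ and $\Phi^+=\{\epsilon_i-\epsilon_j:1\le i<j\le n\}$. A word $u_1\cdots u_N$ is a hook word if $u_1\ge\cdots\ge u_k<u_{k+1}<\cdots<u_N$ for some $1\le k\le N$. A semistandard decomposition tableau is a filling, with letters in $\{1,\dots,n\}$, of a shifted diagram with strictly decreasing row lengths (the $k$-th row from the top shifted $k-1$ units to the right) such that, with $v_k$ the $k$-th row from the top read left to right, each nonempty $v_k$ is a hook word and $v_k$ is a hook subword (not necessarily contiguous) of maximal length in the concatenation $v_{k+1}v_k$. It is dual marginally large if it has $n$ (nonempty) rows and, for each $1\le i\le n$, the number of leftmost $i$-boxes in row $n-i+1$ (the length of the maximal initial run of $i$'s; rows counted from the top) exceeds the total number of boxes of row $n-i+2$ by exactly one (row $n+1$ is empty). $\mathrm{SDT}(-\infty)$ is the set of all dual marginally large semistandard decomposition tableaux. For $T\in\mathrm{SDT}(-\infty)$, let $L_T$ be the tableau of the same shape whose $k$-th row from the top is filled with $n+1-k$; then $\mathrm{wt}(T)=\sum_{j=1}^n(\#j\text{ in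 }T-\#j\text{ in }L_T)\,\epsilon_j$. $\mathrm{rd}(T)$ is the word obtained by reading each row from right to left, rows from top to bottom; $\mathrm{rd}_i(T)$ is its subword of letters $i,i+1$; $\overline{\mathrm{rd}}_i(T)$ is obtained from $\mathrm{rd}_i(T)$ by successively removing adjacent pairs $(i+1,i)$ (in that order), so it consists of $i$'s followed by $(i+1)$'s. Operators $f_i$ on $\mathrm{SDT}(-\infty)$, $i\in I$: for $i\in I_0$, $f_iT=\mathbf0$ if $\overline{\mathrm{rd}}_i(T)$ contains no $i$; otherwise let $T'$ be obtained by changing to $i+1$ the box of the rightmost $i$ in $\overline{\mathrm{rd}}_i(T)$. For $i=\overline1$, $f_{\overline1}T=\mathbf0$ if the leftmost letter of $\mathrm{rd}_1(T)$ is $2$; otherwise let $T'$ be obtained by changing to $2$ the box of the leftmost letter (a $1$) of $\mathrm{rd}_1(T)$. If $T'$ is dual marginally large then $f_iT=T'$; otherwise $f_iT$ is obtained from $T'$ by removing one $(n-k+1)$-box from the left of row $k$ for each $1\le k\le n-i$ (with $i$ replaced by $1$ if $i=\overline1$). An element $T$ is lowest weight if $f_iT=\mathbf0$ for all $i\in I$. *)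

(* Defs.v *)
From mathcomp Require Import all_boot all_order all_algebra.
From mathcomp Require Import finmap.
From mathcomp Require Import classical_sets functions.
Set Implicit Arguments.
Unset Strict Implicit.
Unset Printing Implicit Defensive.
Import GRing.Theory.
Local Open Scope ring_scope.

Definition eps (n : nat) (i : 'I_n) : 'rV[int]_n := delta_mx 0 i.

Definition Phi_plus (n : nat) : {fset 'rV[int]_n} :=
  [fset eps p.1 - eps p.2 | p in [pred p : 'I_n * 'I_n | (p.1 < p.2)%N]]%fset.

(* The hook condition at the (1-based) position k of the turning letter u_k:
   u_k is the last letter of [take k u] and the first of [drop k.-1 u]. *)
Definition hook_word (u : seq nat) : bool :=
  has (fun k => sorted geq (take k u) && sorted ltn (drop k.-1 u))
      (iota 1 (size u)).

(* A filling of a shifted diagram is the list of its rows, from the top, each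
   read left to right.  The offset of each row is not recorded.  Rows and boxes
   of a row are numbered from 0 (the (k+1)-st row from the top is
   [trow T k]); the letters are the natural numbers 1, ..., n. *)
Notation tableau := (seq (seq nat)).

Definition trow (T : tableau) (k : nat) : seq nat := nth [::] T k.

Definition is_sdt (n : nat) (T : tableau) : Prop :=
  [/\ all (all (fun x => (0 < x <= n)%N)) T,
      sorted gtn (shape T),
      all hook_word T
    & forall k : nat, (k < size T)%N ->
        forall w : seq nat, subseq w (trow T k.+1 ++ trow T k) -> hook_word w ->
          (size w <= size (trow T k))%N].

Definition initial_run (i : nat) (s : seq nat) : nat :=
  find (fun x => x != i) s.

Definition dual_marginally_large (n : nat) (T : tableau) : bool :=
  [&& size T == n, all (fun r => r != [::]) T
    & all (fun i => initial_run i (trow T (n - i)%N)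
                    == (size (trow T (n - i).+1)).+1) (iota 1 n)].

Definition SDT_minf (n : nat) (T : tableau) : Prop :=
  is_sdt n T /\ dual_marginally_large n T.

Definition L_tableau (n : nat) (T : tableau) : tableau :=
  mkseq (fun k => nseq (size (trow T k)) (n - k)%N) (size T).

Definition nb_letter (j : nat) (T : tableau) : nat := count_mem j (flatten T).

(* The ordinal j : 'I_n stands for the letter j.+1. *)
Definition wt (n : nat) (T : tableau) : 'rV[int]_n :=
  \sum_(j < n)
    ((nb_letter j.+1 T)%:Z - (nb_letter j.+1 (L_tableau n T))%:Z) *: eps j.

(* Reading words are kept as words of boxes (row, position in the row), so that
   the box carrying a given letter of the word is known. *)
Definition box : Type := (nat * nat)%type.

Definition entry (T : tableau) (b : box) : nat := nth 0%N (trow T b.1) b.2.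

Definition rd (T : tableau) : seq box :=
  [seq (k, c) | k <- iota 0 (size T), c <- rev (iota 0 (size (trow T k)))].

Definition rdi (i : nat) (T : tableau) : seq box :=
  [seq b <- rd T | (entry T b == i) || (entry T b == i.+1)].

Fixpoint remove_pair (i : nat) (T : tableau) (s : seq box) : seq box :=
  match s with
  | b :: ((b' :: s'') as s') =>
      if (entry T b == i.+1) && (entry T b' == i) then s''
      else b :: remove_pair i T s'
  | _ => s
  end.

(* [size s] rounds suffice to remove all the pairs of a word s. *)
Definition rdi_bar (i : nat) (T : tableau) : seq box :=
  iter (size (rdi i T)) (remove_pair i T) (rdi i T).

Definition set_entry (T : tableau) (b : box) (x : nat) : tableau :=
  set_nth [::] T b.1 (set_nth 0%N (trow T b.1) b.2 x).

(* The (0-based) row k < n - i of T' begins with the letter n - k. *)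
Definition normalize (n i : nat) (T' : tableau) : tableau :=
  if dual_marginally_large n T' then T'
  else mkseq (fun k => if (k < n - i)%N then behead (trow T' k) else trow T' k)
             (size T').

(* [None] is the zero element. *)
Definition f_even (n i : nat) (T : tableau) : option tableau :=
  if [seq b <- rdi_bar i T | entry T b == i] is b :: s
  then Some (normalize n i (set_entry T (last b s) i.+1))
  else None.

(* On [SDT_minf n] the word [rdi 1 T] is never empty: the last row of T
   begins with 1. *)
Definition f_odd (n : nat) (T : tableau) : option tableau :=
  if rdi 1 T is b :: _ then
    if entry T b == 2 then None
    else Some (normalize n 1 (set_entry T b 2))
  else None.

Inductive crystal_index (n : nat) : Type :=
| Even (i : nat) of (0 < i < n)%N
| Odd.
Arguments Odd {n}.

Definition f_op (n : nat) (i : crystal_index n) (T : tableau) : option tableau :=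
  match i with
  | Even i _ => f_even n i T
  | Odd => f_odd n T
  end.

Definition lowest_weight (n : nat) : set tableau :=
  [set T | SDT_minf n T /\ forall i : crystal_index n, f_op i T = None]%classic.

(* Main.v *)
Require Import Defs.
From mathcomp Require Import all_boot all_order all_algebra.
From mathcomp Require Import finmap.
From mathcomp Require Import classical_sets functions.
From mathcomp Require Import zify ssrAC.

Set Implicit Arguments.
Unset Strict Implicit.
Unset Printing Implicit Defensive.
Import GRing.Theory.
Local Open Scope nat_scope.

(** Write [u_j] for what remains of the row with leading letter [j] after its
    initial run of [j]'s.  Marginal largeness forces the lengths of the runs,
    and rows with such long runs do not interact: the [u_j] may be chosen
    independently, each one empty or a hook word in the letters 1, ..., j that
    begins below [j] ([sdt_tails], [tails_sdt]).

    By the signature rule, [f_i T = 0] for an ordinary index [i] means that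
    every prefix of the reading word has at least as many letters [i+1] as
    letters [i] ([f_even_None]); for [i = 1] this forces the operator of index
    bar 1 to vanish as well ([f_odd_None]).  The run of [i+1]'s is longer than
    the row below it, which holds all the later [i]'s, so this condition only
    bears on [u_n, ..., u_(i+1)].  Hence [T] has lowest weight exactly when
    [u_n, u_(n-1), ...] are the successive steps of a walk on partitions: the
    state before [u_j] is the sequence of the numbers of letters [j, ..., 1] in
    [u_n, ..., u_(j+1)] ([ballot_chain]).

    The steps from [c] to [l] turn out to be equinumerous with the [k] that
    interlace [c] and for which [l / k] is a vertical strip ([sum_steps]).  So
    the generating function [G_m(c)] of the walks from a state [c] of length [m]
    satisfies [G_(m+1) = B_(m+1) V_m(1 / x_(m+1)) G_m], where [B_m] is the
    branching operator of Schur functions and [V_m(t)] adds a vertical strip,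
    each box of it having weight [t].  The local rule
    [V_(m+1)(t) B_(m+1) = (1 + t x_(m+1)) B_(m+1) V_m(t)] ([add_strip_branch])
    gives by induction the Pieri rule [V_m(t) G_m = prod_i (1 + t x_i) G_m]
    ([pieri]).  Applied with [t = 1 / x_(m+1)] at every stage, it yields that
    [G_n(0)] is the product of the [1 + x_i / x_j] over [i < j]
    ([strip_sum_zero]), which is the generating function of the subsets of the
    positive roots.  (More generally [G_m(c)] is a Schur polynomial times such a
    product.)  Both sets thus have the same weights with the same
    multiplicities, and matching elements of equal weight is the bijection.

    A generating function is represented below by the sums of an arbitrary
    function [phi] of the weight: the factor [1 + x^s] turns [f w] into
    [f w + f (w + s)]. *)

(** * Interlacing sequences and vertical strips *)

(** The bound [M] makes the sums over states finite; it is taken larger than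
    any entry that can occur. *)
Fixpoint vecs (m M : nat) : seq (seq nat) :=
  if m is m'.+1 then [seq x :: l | x <- iota 0 M, l <- vecs m' M] else [:: [::]].

Lemma mem_vecs m M l :
  (l \in vecs m M) = (size l == m) && all (fun x => x < M) l.
Proof.
elim: m l => [|m IHm] [|x l] //=.
  by apply/negbTE/negP => /allpairsP [[a b] [_ _]].
apply/allpairsP/idP => [[[a b] /= [ia ib [-> ->]]]|].
  by move: ib ia; rewrite IHm mem_iota eqSS /= => /andP[-> ->] ->.
rewrite eqSS => /and3P[sl lx al]; exists (x, l); split => //=.
  by rewrite mem_iota.
by rewrite IHm sl.
Qed.

Lemma vecs_uniq m M : uniq (vecs m M).
Proof.
elim: m => //= m IHm; apply: allpairs_uniq => //; first exact: iota_uniq.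
by move=> [a b] [c d] _ _ /= [-> ->].
Qed.

Lemma size_vecs m M l : l \in vecs m M -> size l = m.
Proof. by rewrite mem_vecs => /andP[/eqP]. Qed.

#[global] Arguments vecs : simpl never.

Lemma big_vecsS m M (P : pred (seq nat)) (F : seq nat -> nat) :
  \sum_(l <- vecs m.+1 M | P l) F l =
  \sum_(0 <= x < M) \sum_(l <- vecs m M | P (x :: l)) F (x :: l).
Proof.
rewrite big_mkcond big_allpairs_dep /= /index_iota subn0.
by apply: eq_bigr => x _; rewrite [RHS]big_mkcond.
Qed.

Lemma big_bitsS m (P : pred (seq nat)) (F : seq nat -> nat) :
  \sum_(l <- vecs m.+1 2 | P l) F l =
  \sum_(l <- vecs m 2 | P (0 :: l)) F (0 :: l) +
  \sum_(l <- vecs m 2 | P (1 :: l)) F (1 :: l).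
Proof. by rewrite big_vecsS unlock /= addn0. Qed.

Lemma big_bits0 (P : pred (seq nat)) (F : seq nat -> nat) :
  \sum_(l <- vecs 0 2 | P l) F l = if P [::] then F [::] else 0.
Proof. by rewrite big_mkcond big_seq1. Qed.

Lemma big_andl (I : Type) (r : seq I) (b : bool) (P : pred I) (F : I -> nat) :
  \sum_(i <- r | b && P i) F i = if b then \sum_(i <- r | P i) F i else 0.
Proof. by case: b => //=; rewrite big_pred0_eq. Qed.

(** The sequence [l] interlaces [c + a], that is [c_1 + a_1 >= l_1 >= c_2 +
    a_2 >= ...]. The upper bound [b] on the first entry is what the recursion
    hands over to the next one. *)
Fixpoint interlaces_add (b : nat) (c l a : seq nat) : bool :=
  match c, l, a with
  | x :: c', [::], [:: a1] => (c' == [::]) && (x + a1 <= b)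
  | x :: c', l1 :: l', a1 :: a' => (l1 <= x + a1 <= b) && interlaces_add l1 c' l' a'
  | _, _, _ => false
  end.

(** The sequence [l - a] interlaces [c]; without subtraction, so that an
    entry of [l] smaller than that of [a] is excluded. *)
Fixpoint interlaces_sub (c l a : seq nat) : bool :=
  match c, l, a with
  | x :: c', l1 :: l', a1 :: a' =>
      (head 0 c' + a1 <= l1 <= x + a1) && interlaces_sub c' l' a'
  | x :: c', [::], [::] => c' == [::]
  | _, _, _ => false
  end.

Lemma sum_interlaces_add_cons b x c l1 l (F : seq nat -> nat) :
  \sum_(a <- vecs (size c).+1 2 | interlaces_add b (x :: c) (l1 :: l) a) F a =
  (if l1 <= x <= b then
     \sum_(a <- vecs (size c) 2 | interlaces_add l1 c l a) F (0 :: a) else 0) +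
  (if l1 <= x.+1 <= b then
     \sum_(a <- vecs (size c) 2 | interlaces_add l1 c l a) F (1 :: a) else 0).
Proof.
by rewrite big_bitsS; congr (_ + _); rewrite -big_andl /= ?addn0 ?addn1.
Qed.

Lemma sum_interlaces_sub_cons x y c l1 l (F : seq nat -> nat) :
  \sum_(a <- vecs (size c).+1 2 | interlaces_sub (x :: y :: c) (l1 :: l) a) F a =
  (if y <= l1 <= x then
     \sum_(a <- vecs (size c) 2 | interlaces_sub (y :: c) l a) F (0 :: a) else 0) +
  (if y < l1 <= x.+1 then
     \sum_(a <- vecs (size c) 2 | interlaces_sub (y :: c) l a) F (1 :: a) else 0).
Proof.
by rewrite big_bitsS; congr (_ + _); rewrite -big_andl /= ?addn0 ?addn1.
Qed.

Lemma sum_interlaces_add0 x c l1 l (F : seq nat -> nat) : l1 < x ->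
  \sum_(a <- vecs (size c).+1 2 | interlaces_add l1 (x :: c) l a) F a = 0.
Proof.
move=> lt_lx; apply: big1_seq => a /andP[+ _].
by case: l => [|l2 l]; case: a => [|a1 [|a2 a]] //=; lia.
Qed.

(** The two sides of the commutation of adding a strip with branching, for
    fixed ends [c] and [l]. As generating functions in the size of [a] both
    are products of factors 1, [t] and [1 + t], one for each entry; the
    factors match after a shift by one place, except that the left side has
    one more factor [1 + t], lost when the bound [b] is tight. *)
Lemma sum_interlaces_add b x c l (psi : nat -> nat) :
  path geq x c -> path geq b l -> size c = size l -> x <= b ->
  \sum_(a <- vecs (size c).+1 2 | interlaces_add b (x :: c) l a) psi (sumn a) =
  \sum_(a <- vecs (size c) 2 | interlaces_sub (x :: c) l a)
     (psi (sumn a) + (x < b) * psi (sumn a).+1).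
Proof.
elim: l x b c psi => [|l1 l IHl] x b [|y c] psi //= dc dl sz le_xb.
  rewrite big_bitsS !big_bits0 /= addn0 le_xb addn1.
  by case: ltnP => _; rewrite ?mul1n ?mul0n.
case: sz => sz; move: dc dl => /andP[le_yx dc] /andP[le_lb dl].
rewrite (sum_interlaces_add_cons b x (y :: c)) sum_interlaces_sub_cons.
pose P k := \sum_(a <- vecs (size c) 2 | interlaces_sub (y :: c) l a) psi (k + sumn a).
have PE k k' : \sum_(a <- vecs (size c) 2 | interlaces_sub (y :: c) l a)
     (psi (k + sumn a) + k' * psi (k + sumn a).+1) = P k + k' * P k.+1.
  by rewrite big_split -big_distrr.
have -> : \sum_(a <- vecs (size c) 2 | interlaces_sub (y :: c) l a)
    (psi (sumn (0 :: a)) + (x < b) * psi (sumn (0 :: a)).+1) =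
    P 0 + (x < b) * P 1 by exact: PE 0 _.
have -> : \sum_(a <- vecs (size c) 2 | interlaces_sub (y :: c) l a)
    (psi (sumn (1 :: a)) + (x < b) * psi (sumn (1 :: a)).+1) =
    P 1 + (x < b) * P 2 by exact: PE 1 _.
case: (leqP y l1) => [le_yl|lt_ly]; last first.
  by rewrite !sum_interlaces_add0 // !if_same (ltnNge y) (ltnW lt_ly).
have -> : \sum_(a <- vecs (size (y :: c)) 2 | interlaces_add l1 (y :: c) l a)
    psi (sumn (0 :: a)) = P 0 + (y < l1) * P 1.
  by rewrite -PE; exact: IHl.
have -> : \sum_(a <- vecs (size (y :: c)) 2 | interlaces_add l1 (y :: c) l a)
    psi (sumn (1 :: a)) = P 1 + (y < l1) * P 2.
  by rewrite -PE; exact: (IHl _ _ _ (fun k => psi k.+1)).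
rewrite le_xb andbT.
case: (ltnP y l1) => ?; case: (ltnP x b) => ?; case: (leqP l1 x) => ?;
  case: (leqP l1 x.+1) => ? /=; lia.
Qed.

(** When [c] and [l] agree on all smaller letters, the current letter is at
    most the smallest letter of the word leading from [c] to [l]. The
    smallest letter must belong to the falling part of a hook word, so it is
    barred from the rising part [a]. *)
Fixpoint min_is_falling (c l a : seq nat) : bool :=
  match c, a with
  | _ :: c', a1 :: a' => ((c' == l) ==> (a1 == 0)) && min_is_falling c' (behead l) a'
  | _, _ => true
  end.

Lemma sum_min_falling_cons b x c l1 l (F : seq nat -> nat) :
  \sum_(a <- vecs (size c).+1 2 |
      interlaces_add b (x :: c) (l1 :: l) a &&
      min_is_falling (x :: c) (l1 :: l) a) F a =
  (if l1 <= x <= b then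
     \sum_(a <- vecs (size c) 2 |
        interlaces_add l1 c l a && min_is_falling c l a) F (0 :: a)
   else 0) +
  (if (l1 <= x.+1 <= b) && (c != l1 :: l) then
     \sum_(a <- vecs (size c) 2 |
        interlaces_add l1 c l a && min_is_falling c l a) F (1 :: a)
   else 0).
Proof.
rewrite big_bitsS; congr (_ + _); rewrite -[RHS]big_andl; apply: eq_bigl => a.
  by rewrite /= addn0 implybT !andbA andbT.
rewrite /= addn1 -!andbA.
by case: (c == _); rewrite ?andbF //= ?andbT.
Qed.

(** The factor [1 + t] by which [sum_interlaces_add] exceeds branching is the
    free choice at the smallest letter of the word, which is the choice that
    [min_is_falling] removes. If [b] is tight, there is no such factor at the
    head, but a smaller letter of the word, if any, still loses its choice:
    hence the 2. *)
Lemma sum_min_falling b x c l :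
  path geq x c -> path geq b l -> size c = size l -> x <= b ->
  (if (x < b) || (c == l) then 1 else 2) *
  \sum_(a <- vecs (size c).+1 2 |
     interlaces_add b (x :: c) l a && min_is_falling (x :: c) l a) 1 =
  \sum_(a <- vecs (size c) 2 | interlaces_sub (x :: c) l a) 1.
Proof.
elim: l x b c => [|l1 l IHl] x b [|y c] //= dc dl sz le_xb.
  by rewrite orbT big_bitsS !big_bits0 /= addn0 le_xb andbF.
case: sz => sz; move: dc dl => /andP[le_yx dc] /andP[le_lb dl].
rewrite (sum_min_falling_cons b x (y :: c)) sum_interlaces_sub_cons.
set P := \sum_(a <- vecs (size c) 2 | _) 1.
case: (leqP y l1) => [le_yl|lt_ly]; last first.
  rewrite (ltnNge y) (ltnW lt_ly) /=.
  rewrite big1_seq ?if_same ?muln0 // => a /andP[/andP[qa _] ia].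
  have := sum_interlaces_add0 c l (fun=> 1) lt_ly.
  by rewrite (big_rem a ia) /= qa.
have := IHl y l1 c dc dl sz le_yl; rewrite -/P.
set H := \sum_(a <- _ | _) 1.
rewrite le_xb andbT !eqseq_cons.
case: eqP => [e|_]; case: (ltnP y l1) => ?; case: (ltnP x b) => ?;
  case: (leqP l1 x) => ?; case: (leqP l1 x.+1) => ?; case: eqP => ? /=; lia.
Qed.

Fixpoint addv (c a : seq nat) : seq nat :=
  if (c, a) is (x :: c', y :: a') then x + y :: addv c' a' else [::].

Lemma size_addv c a : size c = size a -> size (addv c a) = size c.
Proof. by elim: c a => [|x c IH] [|y a] //= [/IH ->]. Qed.

Lemma sumn_addv c a : size c = size a -> sumn (addv c a) = sumn c + sumn a.
Proof. by elim: c a => [|x c IH] [|y a] //= [/IH ->]; rewrite addnACA. Qed.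

(** Interlacing as in Gelfand-Tsetlin patterns: [c_1 >= k_1 >= c_2 >= ...]. *)
Fixpoint interlaces (c k : seq nat) : bool :=
  match c, k with
  | x :: c', z :: k' => (head 0 c' <= z <= x) && interlaces c' k'
  | x :: c', [::] => c' == [::]
  | _, _ => false
  end.

Lemma interlaces_path b c l : head 0 c <= b -> size c = (size l).+1 ->
  interlaces c l -> path geq b l.
Proof.
elim: l b c => //= l1 l IH b [|x c] //= le_xb [sz] /andP[/andP[h1 h2] h3].
by rewrite (IH l1 c) // (leq_trans h2).
Qed.

Lemma interlaces_sorted c l :
  size c = (size l).+1 -> interlaces c l -> sorted geq c.
Proof.
elim: l c => [|l1 l IH] [|x [|y c]] //= [sz] /andP[/andP[h1 h2] h3].
rewrite (leq_trans h1 h2) /=; apply: (IH (y :: c)) => //=; by rewrite sz.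
Qed.

Lemma interlaces_addv b c l a : size a = size c -> size c = (size l).+1 ->
  (head 0 c) < b -> all (fun x => x < 2) a ->
  interlaces (addv c a) l = interlaces_add b c l a.
Proof.
elim: l b c a => [|l1 l IH] b [|x c] [|a1 a] //=.
  case: a c => [|? ?] [|? ?] // _ _; rewrite /= ?andbT => h ?.
  by rewrite eqxx; apply/esym; lia.
move=> [sa] [sc] lt_xb /andP[la1 la].
have -> : (l1 <= x + a1 <= b) = (l1 <= x + a1) by lia.
case: c a sa sc la => [|y c] [|a2 a] //= sa sc /andP[la2 la].
have all2 : all (fun x => x < 2) (a2 :: a) by rewrite /= la2.
have [lt_yl|le_ly] := ltnP y l1.
  have /= -> := IH l1 (y :: c) (a2 :: a) sa sc lt_yl all2.
  by have -> : y + a2 <= l1 by lia.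
have /= -> := IH y.+1 (y :: c) (a2 :: a) sa sc (leqnn _) all2.
case: l {IH} sc => [|l2 l] sc /=.
  case: c a sa sc {la all2} => [|? ?] [|? ?] //= _ _; rewrite ?eqxx /=.
  have -> : y + a2 <= y.+1 by lia. by rewrite andbT andbC.
have -> : (l2 <= y + a2 <= y.+1) = (l2 <= y + a2) by lia.
by case: (y + a2 <= l1); rewrite ?andbF ?andbT.
Qed.

Lemma sum_shift M lo hi a (F : nat -> nat) : a < 2 -> hi.+1 < M ->
  \sum_(0 <= v < M | lo + a <= v <= hi + a) F v =
  \sum_(0 <= k < M | lo <= k <= hi) F (k + a).
Proof.
case: a => [|[|//]] _ lt_hM.
  by under [RHS]eq_bigr do rewrite addn0; under eq_bigl do rewrite !addn0.
case: M lt_hM => // M lt_hM.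
rewrite big_mkcond big_nat_recl //= addn1 ltn0 /= add0n.
rewrite [RHS]big_mkcond big_nat_recr //=.
rewrite (_ : (lo <= M <= hi) = false) ?addn0; last by apply/negbTE; lia.
by apply: eq_bigr => k _; rewrite !addn1 !ltnS.
Qed.

Lemma sum_vecs_shift M x c a (F : seq nat -> nat) :
  size a = size c -> all (fun x => x < 2) a -> path geq x c -> x.+1 < M ->
  \sum_(l <- vecs (size c) M | interlaces_sub (x :: c) l a) F l =
  \sum_(k <- vecs (size c) M | interlaces (x :: c) k) F (addv k a).
Proof.
elim: c x a F => [|y c IH] x [|a1 a] F //=.
  by move=> *; rewrite !unlock.
move=> [sa] /andP[la1 la] /andP[le_yx dc] lt_xM; rewrite !big_vecsS.
pose f v l := F (v :: l).
transitivity (\sum_(0 <= v < M | y + a1 <= v <= x + a1)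
   \sum_(k <- vecs (size c) M | interlaces (y :: c) k) f v (addv k a)).
  rewrite [RHS]big_mkcond; apply: eq_bigr => v _.
  rewrite -(IH y a (f v)) ?(leq_ltn_trans _ lt_xM) //.
  by rewrite -big_andl; apply: eq_bigl.
rewrite sum_shift // big_mkcond; apply: eq_bigr => v _.
by rewrite -big_andl; apply: eq_bigl.
Qed.

(** Both sides run over the pairs of [k] interlacing [x :: c] and of a
    vertical strip [a] with [l = k + a]. *)
Lemma sum_strip_exchange M x c (Phi : seq nat -> seq nat -> nat) :
  path geq x c -> x.+1 < M ->
  \sum_(l <- vecs (size c) M | sorted geq l)
     \sum_(a <- vecs (size c) 2 | interlaces_sub (x :: c) l a) Phi l a =
  \sum_(k <- vecs (size c) M | interlaces (x :: c) k)
     \sum_(a <- vecs (size c) 2 | sorted geq (addv k a)) Phi (addv k a) a.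
Proof.
move=> dc lt_xM.
pose Psi a l := if sorted geq l then Phi l a else 0.
transitivity (\sum_(a <- vecs (size c) 2)
   \sum_(l <- vecs (size c) M | interlaces_sub (x :: c) l a) Psi a l).
  under [RHS]eq_bigr do rewrite big_mkcond.
  rewrite exchange_big [LHS]big_mkcond; apply: eq_bigr => l _.
  rewrite /Psi; case: ifP => _; last by rewrite big1 // => a _; rewrite if_same.
  by rewrite big_mkcond.
transitivity (\sum_(a <- vecs (size c) 2)
   \sum_(k <- vecs (size c) M | interlaces (x :: c) k) Psi a (addv k a)).
  apply: eq_big_seq => a; rewrite mem_vecs => /andP[/eqP sa la].
  exact: sum_vecs_shift.
rewrite exchange_big; apply: eq_bigr => k _.
by rewrite -big_mkcond.
Qed.

(** * The Pieri rule *)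

Lemma eq_big_vecs m M (P : pred (seq nat)) (F1 F2 : seq nat -> nat) :
  (forall l, size l = m -> all (fun x => x < M) l -> P l -> F1 l = F2 l) ->
  \sum_(l <- vecs m M | P l) F1 l = \sum_(l <- vecs m M | P l) F2 l.
Proof.
move=> e; rewrite big_seq_cond [RHS]big_seq_cond; apply: eq_bigr => l.
by rewrite mem_vecs => /andP[/andP[/eqP sl al] Pl]; apply: e.
Qed.

Section Pieri.
Variables (W : zmodType) (X : nat -> W) (M : nat) (phi : W -> nat).

Fixpoint subsums (us : seq W) : seq W :=
  if us is u :: us' then subsums us' ++ [seq (u + s)%R | s <- subsums us']
  else [:: 0%R].

Lemma sum_subsums_cons u us (f : W -> nat) :
  \sum_(s <- subsums (u :: us)) f s =
  \sum_(s <- subsums us) (f s + f (u + s)%R).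
Proof. by rewrite /= big_cat big_map big_split. Qed.

Lemma sum_subsums_cat us vs (f : W -> nat) :
  \sum_(s <- subsums (us ++ vs)) f s =
  \sum_(s <- subsums us) \sum_(t <- subsums vs) f (s + t)%R.
Proof.
elim: us f => [|u us IH] f.
  by rewrite big_seq1; apply: eq_bigr => t _; rewrite add0r.
rewrite cat_cons !sum_subsums_cons big_split /= (IH f) IH.
rewrite big_split /=; congr (_ + _).
by apply: eq_bigr => s _; apply: eq_bigr => t _; rewrite addrA.
Qed.

(** A letter of the word leading from [c] to [l] weighs its variable divided
    by that of the largest letter. So weights have the same degree before and
    after, and the final exponent of the largest letter, which is dropped, is
    the difference of the two sums. *)
Definition drop_weight (c l : seq nat) : W :=
  (X (size c) *+ sumn c - X (size c) *+ sumn l)%R.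

(** The generating function of walks, with steps counted by strips: as an
    operator, one stage is the composite of [branch] and of [add_strip] for
    the inverse of the variable of the dropped letter ([strip_sum_branch]). *)
Fixpoint strip_sum (m : nat) (c : seq nat) (w : W) : nat :=
  if m is m'.+1 then
    \sum_(l <- vecs m' M | sorted geq l)
      \sum_(a <- vecs m' 2 | interlaces_sub c l a)
        strip_sum m' l (w + drop_weight c l)%R
  else phi w.

Definition add_strip (F : seq nat -> W -> nat) (t : W) (c : seq nat) (w : W) : nat :=
  \sum_(a <- vecs (size c) 2 | sorted geq (addv c a))
    F (addv c a) (w + t *+ sumn a)%R.

Definition branch (F : seq nat -> W -> nat) (c : seq nat) (w : W) : nat :=
  \sum_(k <- vecs (size c).-1 M | interlaces c k) F k (w + drop_weight c k)%R.

Lemma strip_sum_branch m c w :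
  size c = m.+1 -> sorted geq c -> (head 0 c).+1 < M ->
  strip_sum m.+1 c w = branch (add_strip (strip_sum m) (- X m.+1)%R) c w.
Proof.
case: c => // x c [sc] dc lt_xM; rewrite /branch /= -sc.
rewrite (sum_strip_exchange
  (fun l _ => strip_sum (size c) l (w + drop_weight (x :: c) l)%R) dc lt_xM).
apply: eq_big_vecs => k sk _ _; rewrite /add_strip sk.
apply: eq_big_vecs => a sa _ _; congr (strip_sum _ _ _).
rewrite /drop_weight /= sumn_addv ?sk ?sa // !mulrnDr mulNrn opprD.
by rewrite !addrA.
Qed.

Lemma strip_weight (w t x : W) (C K k : nat) :
  (w + t *+ k + (x *+ (C + k) - x *+ (K + k)) =
   w + (x *+ C - x *+ K) + t *+ k)%R.
Proof. by rewrite !mulrnDr opprD [X in (_ + X)%R]addrACA subrr addr0 addrAC. Qed.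

Lemma strip_weightS (w t x : W) (C K k : nat) :
  (w + t *+ k.+1 + (x *+ (C + k.+1) - x *+ (K + k)) =
   w + (x + t) + (x *+ C - x *+ K) + t *+ k)%R.
Proof.
rewrite -strip_weight addnS !mulrS -[(x + _ - _)%R]addrA.
by rewrite [LHS](AC (1*2*2) (1*(4*2)*3*5))%R.
Qed.

(** For fixed ends this is [sum_interlaces_add]: its second summand, where
    the size of the strip has grown by one, is the factor [t x]. *)
Lemma add_strip_branch m t c w F : size c = m.+1 -> sorted geq c ->
  (head 0 c).+1 < M ->
  add_strip (branch F) t c w =
  branch (add_strip F t) c w + branch (add_strip F t) c (w + (X m.+1 + t))%R.
Proof.
case: c => // x c [sc] dc lt_xM.
pose psi l k := F l (w + t *+ k + (X m.+1 *+ (x + sumn c + k) -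
                                   X m.+1 *+ sumn l))%R.
transitivity (\sum_(l <- vecs m M | sorted geq l)
   \sum_(a <- vecs m 2 | interlaces_sub (x :: c) l a)
      (psi l (sumn a) + psi l (sumn a).+1)).
  transitivity (\sum_(a <- vecs m.+1 2) \sum_(l <- vecs m M | sorted geq l)
      if interlaces (addv (x :: c) a) l then psi l (sumn a) else 0).
    rewrite /add_strip -[size _]/(size c).+1 sc big_mkcond; apply: eq_big_vecs => a sa _ _.
    have sz : size (addv (x :: c) a) = m.+1 by rewrite size_addv /= ?sa ?sc.
    rewrite /branch sz -[m.+1.-1]/m.
    transitivity (\sum_(l <- vecs m M | interlaces (addv (x :: c) a) l)
       psi l (sumn a)).
      case: ifP => ds.
        apply: eq_big_vecs => l sl _ _; congr (F _ _).
        by rewrite /drop_weight sz sumn_addv //= sc sa.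
      rewrite big1_seq // => l /andP[il]; rewrite mem_vecs => /andP[/eqP sl _].
      by rewrite (interlaces_sorted _ il) ?sz ?sl in ds.
    rewrite big_mkcond [RHS]big_mkcond; apply: eq_big_vecs => l sl _ _.
    case: ifP => il; last by rewrite if_same.
    by rewrite (path_sorted (interlaces_path (leqnn _) _ il)) ?sz ?sl.
  rewrite exchange_big; apply: eq_big_vecs => l sl _ dl.
  rewrite -big_mkcond -sc.
  (* Any bound above [x] and the entries of [l] makes the condition on the
     first entry of the strip void. *)
  pose b := maxn x.+1 (head 0 l).
  have lt_xb : x < b by rewrite /b; lia.
  have dbl : path geq b l.
    by case: (l) dl @b {lt_xb} => //= y l' -> /=; rewrite andbT leq_maxr.
  have := sum_interlaces_add (psi l) dc dbl _ (ltnW lt_xb).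
  rewrite sc sl lt_xb => /(_ erefl); under [RHS]eq_bigr do rewrite mul1n.
  move=> <-; rewrite big_seq_cond [RHS]big_seq_cond; apply: eq_bigl => a.
  rewrite mem_vecs; case: eqP => // sa; case: (boolP (all _ a)) => // al.
  rewrite !andTb; apply: interlaces_addv; rewrite //= ?sa ?sc ?sl //.
rewrite -sc (sum_strip_exchange
  (fun l a => psi l (sumn a) + psi l (sumn a).+1) dc lt_xM).
rewrite /branch /= -big_split /=; apply: eq_big_vecs => k sk _ _.
rewrite /add_strip sk -big_split /=; apply: eq_big_vecs => a sa _ _.
have e : drop_weight (x :: c) k = (X m.+1 *+ (x + sumn c) - X m.+1 *+ sumn k)%R.
  by rewrite /drop_weight /= sc.
rewrite /psi sumn_addv ?sk ?sa // e; congr (F _ _ + F _ _).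
  exact: strip_weight.
by rewrite sc; exact: strip_weightS.
Qed.

Fixpoint shifted_letters (m : nat) (t : W) : seq W :=
  if m is m'.+1 then (X m + t)%R :: shifted_letters m' t else [::].

Fixpoint root_list (m : nat) : seq W :=
  if m is m'.+1 then shifted_letters m' (- X m)%R ++ root_list m' else [::].

(** The Pieri rule, at length [m]. A step makes the entries grow by at most
    one, so that the bound [M] leaves room for [m] steps and for the strip
    [t]. *)
Definition pieri_at m := forall t c w,
  size c = m -> sorted geq c -> head 0 c + m.+1 < M ->
  add_strip (strip_sum m) t c w =
  \sum_(s <- subsums (shifted_letters m t)) strip_sum m c (w + s)%R.

Lemma interlaces_head c k : interlaces c k -> head 0 k <= head 0 c.
Proof. by case: c => // x c; case: k => //= z k /andP[/andP[]]. Qed.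

Lemma branch_add_strip m t c w : pieri_at m ->
  size c = m.+1 -> sorted geq c -> head 0 c + m.+1 < M ->
  branch (add_strip (strip_sum m) t) c w =
  \sum_(s <- subsums (shifted_letters m t)) branch (strip_sum m) c (w + s)%R.
Proof.
move=> Pm sc dc hM; rewrite /branch sc /= exchange_big.
apply: eq_big_vecs => k sk _ ik; rewrite Pm //.
- by apply: eq_bigr => s _; rewrite addrAC.
- by apply: path_sorted (interlaces_path (leqnn _) _ ik); rewrite sc sk.
- by have := interlaces_head ik; lia.
Qed.

(** The Pieri rule at length [m] turns the strip of the first step into a
    product of factors. *)
Lemma strip_sum_step m c w : pieri_at m ->
  size c = m.+1 -> sorted geq c -> head 0 c + m.+1 < M ->
  strip_sum m.+1 c w =
  \sum_(s <- subsums (shifted_letters m (- X m.+1)%R)) branch (strip_sum m) c (w + s)%R.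
Proof.
by move=> Pm sc dc hM; rewrite strip_sum_branch ?branch_add_strip //; lia.
Qed.

(** By [strip_sum_step], [G_(m+1)] is a product of factors times the
    branching of [G_m]. The strip passes through the factors, then through
    the branching at the cost of the new factor [t + X (m+1)], and is
    absorbed by [G_m]. *)
Lemma pieri m : pieri_at m.
Proof.
elim: m => [|m IH] t c w sc dc hM.
  by case: c sc dc hM => //= *; rewrite /add_strip big_bits0 big_seq1.
have head_addv a : size a = size c -> all (fun x => x < 2) a ->
    head 0 (addv c a) <= (head 0 c).+1.
  by case: c {sc dc hM} => // x c; case: a => //= y a _ /andP[? _]; lia.
have -> : add_strip (strip_sum m.+1) t c w =
  \sum_(s <- subsums (shifted_letters m (- X m.+1)%R))
    add_strip (branch (strip_sum m)) t c (w + s)%R.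
  rewrite /add_strip [RHS]exchange_big; apply: eq_big_vecs => a sa la da.
  rewrite strip_sum_step ?size_addv //; last by have := head_addv a sa la; lia.
  by apply: eq_bigr => s _; rewrite addrAC.
transitivity (\sum_(s <- subsums (shifted_letters m (- X m.+1)%R))
  \sum_(s' <- subsums (shifted_letters m.+1 t)) branch (strip_sum m) c (w + s' + s)%R).
  apply: eq_bigr => s _; rewrite (add_strip_branch (m := m)) //; last by lia.
  rewrite !branch_add_strip //; try lia; rewrite sum_subsums_cons -big_split.
  apply: eq_bigr => s' _; congr (branch _ _ _ + branch _ _ _).
    by rewrite addrAC.
  by rewrite [LHS](AC (1*1*1*1) (1*(3*4)*2))%R.
rewrite exchange_big; apply: eq_bigr => s' _.
by rewrite strip_sum_step //; lia.
Qed.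

(** Only the zero sequence interlaces the zero sequence, so that from the
    zero state every branching is trivial and only the factors remain. *)
Lemma strip_sum_zero m w : m.+1 < M ->
  strip_sum m (nseq m 0) w = \sum_(s <- subsums (root_list m)) phi (w + s)%R.
Proof.
elim: m w => [|m IH] w hM; first by rewrite big_seq1 addr0.
have nseq_sorted k : sorted geq (nseq k 0) by elim: k => [|[|k] IHk].
rewrite (strip_sum_step _ (pieri (m := m))) ?size_nseq //; last exact: ltnW.
rewrite sum_subsums_cat; apply: eq_bigr => s _.
under [RHS]eq_bigr do rewrite addrA.
rewrite -IH; last lia; rewrite /branch size_nseq -[m.+1.-1]/m.
have i0 : interlaces (nseq m.+1 0) (nseq m 0).
  by elim: (m) => //= k ->; case: k.
have iP k : size k = m -> interlaces (nseq m.+1 0) k -> k = nseq m 0.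
  elim: (m) k => [|k IHk] [|z l] //= [sl] /andP[h /(IHk _ sl) ->].
  by have -> : z = 0 by lia.
rewrite (big_rem (nseq m 0)) ?i0 /=; last first.
  by rewrite mem_vecs size_nseq eqxx all_nseq (ltn_trans _ hM) ?orbT.
rewrite big1_seq => [|k /andP[ik]]; last first.
  rewrite mem_rem_uniq ?vecs_uniq // inE => /andP[/eqP ne].
  by move/size_vecs => sk; case: ne; apply: iP.
by rewrite addn0 /drop_weight /= add0n subrr addr0.

Qed.
End Pieri.

(** * Ballot words *)

(** Reading [w] with [a] letters [i] and [b] letters [i.+1] already read, the
    former never outnumber the latter. *)
Fixpoint ballot (i a b : nat) (w : seq nat) : bool :=
  (a <= b) &&
  if w is x :: w' then ballot i (a + (x == i)) (b + (x == i.+1)) w' else true.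

Lemma ballot_le (i a b : nat) (w : seq nat) : ballot i a b w -> a <= b.
Proof. by case: w => [|x w] /= /andP[]. Qed.

Lemma ballot_cat (i a b : nat) (u v : seq nat) :
  ballot i a b (u ++ v) =
  ballot i a b u && ballot i (a + count_mem i u) (b + count_mem i.+1 u) v.
Proof.
elim: u a b => [|x u IH] a b /=.
  rewrite !addn0 andbT; apply/idP/idP => [bv|/andP[]//].
  by rewrite bv (ballot_le bv).
by rewrite IH andbA !addnA.
Qed.

Lemma ballot_count (i a b : nat) (w : seq nat) :
  ballot i a b w -> a + count_mem i w <= b + count_mem i.+1 w.
Proof.
by rewrite -[in ballot _ _ _ w](cats0 w) ballot_cat /= andbT => /andP[].
Qed.

Lemma ballot_few (i a b : nat) (w : seq nat) :
  a + count_mem i w <= b -> ballot i a b w.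
Proof.
elim: w a b => [|x w IH] a b /= h; first by lia.
rewrite IH; first by rewrite andbT; lia.
by rewrite -addnA (leq_trans h) ?leq_addr.
Qed.

Lemma ballot_notin (i a b : nat) (w : seq nat) :
  count_mem i w = 0 -> a <= b -> ballot i a b w.
Proof. by move=> w0 le_ab; rewrite ballot_few // w0 addn0. Qed.

Lemma count_mem0 (x : nat) (s : seq nat) :
  (forall y, y \in s -> y != x) -> count_mem x s = 0.
Proof.
move=> h; apply/eqP; rewrite -leqn0 leqNgt -has_count; apply/hasPn => y /h.
by [].
Qed.

(** All letters [i] come before the letters [i.+1], so the latter are of no
    help. *)
Lemma ballot_incr (i a b : nat) (w : seq nat) : sorted leq w ->
  ballot i a b w = (a + count_mem i w <= b).
Proof.
elim: w a b => [|x w IH] a b //= xw; first by rewrite addn0 andbT.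
have sw : sorted leq w by apply: path_sorted xw.
have key m : (a <= b) && (a + m <= b) = (a + m <= b) by lia.
rewrite IH //; case: (ltngtP x i) => h /=.
- by rewrite (_ : x == i.+1 = false) ?addn0 ?add0n ?key //; apply/eqP; lia.
- have -> : count_mem i w = 0.
    apply: count_mem0 => y yw; have := order_path_min leq_trans xw.
    by move/allP/(_ _ yw); lia.
  by rewrite !addn0; case: eqP => _; lia.
- by rewrite h (_ : i == i.+1 = false) ?addn0 ?addnA; [lia|apply/eqP; lia].
Qed.

Lemma gtn_trans : transitive gtn.
Proof. by move=> y x z /= h1 h2; apply: ltn_trans h2 h1. Qed.

(** The letter [i.+1], if any, comes before [i]. *)
Lemma ballot_decr (i a b : nat) (w : seq nat) : sorted gtn w ->
  ballot i a b w = (a <= b) && (a + count_mem i w <= b + count_mem i.+1 w).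
Proof.
elim: w a b => [|x w IH] a b //= xw; first by rewrite !addn0 andbT andbb.
have sw : sorted gtn w by apply: path_sorted xw.
have xmin y : y \in w -> y < x.
  by move=> yw; have /allP/(_ _ yw) := order_path_min gtn_trans xw.
rewrite IH //; have [exi|nxi] := eqVneq x i.
  subst x; rewrite (_ : count_mem i w = 0); last first.
    by apply: count_mem0 => y /xmin; lia.
  rewrite (_ : count_mem i.+1 w = 0); last first.
    by apply: count_mem0 => y /xmin; lia.
  by rewrite (_ : i == i.+1 = false) /= ?addn0; [lia|apply/eqP; lia].
rewrite /= addn0 add0n; have [exi|nxi'] := eqVneq x i.+1.
  subst x; rewrite (_ : count_mem i.+1 w = 0); last first.
    by apply: count_mem0 => y /xmin; lia.
  by rewrite /= addn0; lia.
by rewrite addn0 add0n; lia.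
Qed.

(** * Multiplicities of letters *)

(** A state lists multiplicities from the largest letter down to 1, so that
    dropping the largest letter is removing the head. *)
Definition mult (c : seq nat) (x : nat) : nat := nth 0 c (size c - x).

Definition by_letter (m : nat) (f : nat -> nat) : seq nat :=
  [seq f x | x <- rev (iota 1 m)].

Lemma size_by_letter m f : size (by_letter m f) = m.
Proof. by rewrite size_map size_rev size_iota. Qed.

Lemma mult_by_letter m f x : 0 < x <= m -> mult (by_letter m f) x = f x.
Proof.
move=> xm; rewrite /mult size_by_letter (nth_map 0) ?size_rev ?size_iota; last lia.
rewrite nth_rev ?size_iota ?nth_iota; try lia.
by congr f; lia.
Qed.

Lemma mult_ext c d : size c = size d ->
  (forall x, 0 < x <= size c -> mult c x = mult d x) -> c = d.
Proof.
move=> sz e; apply: (@eq_from_nth _ 0) => // i lt_i.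
have := e (size c - i); rewrite /mult -sz subKn ?(ltnW lt_i) //; apply; lia.
Qed.

Lemma mult_cons y c x : x <= size c -> mult (y :: c) x = mult c x.
Proof. by move=> h; rewrite /mult /= subSn. Qed.

Lemma mult_head y c : mult (y :: c) (size c).+1 = y.
Proof. by rewrite /mult /= subnn. Qed.

Lemma interlaces_addP b c l a : size c = (size l).+1 -> size a = size c ->
  reflect (mult c (size c) + mult a (size c) <= b /\
    forall x, 0 < x <= size l ->
      mult l x <= mult c x.+1 + mult a x.+1 /\ mult c x + mult a x <= mult l x)
   (interlaces_add b c l a).
Proof.
elim: l b c a => [|l1 l IH] b [|y c] [|a1 a] // [sc] [sa].
  case: c sc sa => //; case: a => //= _ _; rewrite /mult /= ?eqxx /=.
  by apply: (iffP idP) => [h|[]//]; split=> // x; lia.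
have yE : mult (y :: c) (size (y :: c)) = y by rewrite mult_head.
have aE : mult (a1 :: a) (size (y :: c)) = a1 by rewrite /= -sa mult_head.
have lE : mult (l1 :: l) (size c) = l1 by rewrite sc mult_head.
rewrite yE aE [interlaces_add _ _ _ _]/=.
apply: (iffP andP) => [[/andP[h1 h2] /IH]|[h1 h2]].
  rewrite sc sa => /(_ erefl sc) [h3 h4]; split=> // x xl.
  have [->|ne] := eqVneq x (size c).
    by rewrite lE -[(size c).+1]/(size (y :: c)) yE aE !mult_cons ?sa // sc.
  have xc : x < size c by move: xl ne; rewrite /= sc => ? /eqP; lia.
  by rewrite !mult_cons ?sa ?(ltnW xc) //; [apply: h4; lia|lia].
have sl : 0 < size c <= size (l1 :: l) by rewrite sc /= leqnn.
have [] := h2 _ sl; rewrite lE -[(size c).+1]/(size (y :: c)) yE aE.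
rewrite !mult_cons ?sa // => h3 h4; split; first by rewrite h3 h1.
apply/IH => //; split=> // x xl; have := h2 x; rewrite !mult_cons ?sa; try lia.
Qed.

Lemma min_is_fallingP c l a : size c = (size l).+1 -> size a = size c ->
  reflect (forall x, 0 < x <= size c ->
     (forall y, 0 < y < x -> mult c y = mult l y) -> mult a x = 0)
   (min_is_falling c l a).
Proof.
elim: c l a => [|y c IH] l [|a1 a] // [sc] [sa].
have yE : mult (a1 :: a) (size (y :: c)) = a1 by rewrite /= -sa mult_head.
rewrite [min_is_falling _ _ _]/=; apply: (iffP andP) => [[h1 h2] x xc h|h].
  have [ex|ne] := eqVneq x (size (y :: c)).
    rewrite ex yE; move/implyP: h1 => /(_ _)/eqP; apply; apply/eqP.
    apply: mult_ext => // z zc; rewrite -h ?mult_cons //; last by rewrite ex /=; lia.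
    by case/andP: zc.
  have xc' : x <= size c by move: xc ne; rewrite /= => ? /eqP; lia.
  rewrite mult_cons ?sa //.
  case: l sc h1 h2 h => [|l1 l] sc h1 h2 h; first by rewrite /= in sc; lia.
  move: h2 => /IH; rewrite sc sa => /(_ erefl sc) h2.
  apply: h2; first by rewrite sc in xc'; lia.
  move=> z zx; have := h z zx; rewrite !mult_cons //; last lia.
  by rewrite sc in xc'; rewrite /= in xc'; lia.
split.
  apply/implyP => /eqP e; rewrite -[X in X == _]yE; apply/eqP; apply: h => //=.
  by move=> z zc; rewrite mult_cons ?e //; lia.
case: l sc h => [|l1 l] sc h; first by case: c {IH} sc sa {h yE} => //; case: (a).
apply/IH => // x xc hx; have := h x; rewrite mult_cons ?sa; last lia.
apply; first by rewrite /=; lia.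
by move=> z zx; rewrite !mult_cons ?hx //; rewrite /= in sc; lia.
Qed.

(** * Hook words *)

Fixpoint dec_word (d : seq nat) : seq nat :=
  if d is k :: d' then nseq k (size d) ++ dec_word d' else [::].

Lemma dec_word_letters d x : x \in dec_word d -> 0 < x <= size d.
Proof.
elim: d => //= k d IH; rewrite mem_cat => /orP[|/IH]; last by lia.
by move/nseqP => [-> _]; rewrite /= leqnn.
Qed.

Lemma geq_trans : transitive geq.
Proof. by move=> y x z /= h1 h2; apply: leq_trans h2 h1. Qed.

Lemma dec_word_sorted d : sorted geq (dec_word d).
Proof.
elim: d => //= k d IH; rewrite (sorted_pairwise geq_trans) pairwise_cat.
rewrite -!(sorted_pairwise geq_trans) IH andbT; apply/andP; split.
  apply/allrelP => x y /nseqP[-> _] /dec_word_letters /=; lia.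
elim: k => // -[|k] //= ->; by rewrite leqnn.
Qed.

Lemma count_dec_word d x :
  0 < x <= size d -> count_mem x (dec_word d) = mult d x.
Proof.
elim: d => [|k d IH] /= xd; first by lia.
rewrite count_cat count_nseq /=; case: (eqVneq x (size d).+1) => [ex|ne].
  by rewrite ex mult_head mul1n count_mem0 ?addn0 // => y /dec_word_letters; lia.
by rewrite mul0n add0n mult_cons ?IH //; move/eqP: ne; lia.
Qed.

Lemma dec_word_strict d : all (fun x => x < 2) d -> sorted gtn (dec_word d).
Proof.
elim: d => //= k d IH /andP[lk /IH sd].
have : path gtn (size d).+1 (dec_word d).
  rewrite (path_sortedE gtn_trans) sd andbT; apply/allP => x /dec_word_letters /=.
  lia.
by case: k lk => [|[|//]] //= _; rewrite ?add0n.
Qed.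

Lemma dec_word_unique w m : sorted geq w -> all (fun x => 0 < x <= m) w ->
  w = dec_word (by_letter m (fun x => count_mem x w)).
Proof.
move=> sw lw; apply: (sorted_eq geq_trans _ sw (dec_word_sorted _)).
  by move=> x y /= /andP[h1 h2]; apply/eqP; rewrite eqn_leq h1 h2.
apply/allP => x _ /=; apply/eqP.
have [xm|nxm] := boolP (0 < x <= m).
  by rewrite count_dec_word ?size_by_letter // mult_by_letter.
rewrite !count_mem0 // => y; last by move/allP: lw => h /h; apply: contraTneq => ->.
by move/dec_word_letters; rewrite size_by_letter; apply: contraTneq => ->.
Qed.

(** The turning letter is counted in the falling part [D]; a rising part
    alone is excluded, which makes the split of a word unique. *)
Definition hook_split (D E : seq nat) : bool :=
  [&& sorted geq D, sorted ltn E &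
      (E != [::]) ==> (D != [::]) && all (fun x => last 0 D < x) E].

Lemma hook_splitP S :
  reflect (exists D E, S = D ++ E /\ hook_split D E) ((S == [::]) || hook_word S).
Proof.
apply: (iffP idP) => [/orP[/eqP->|/hasP[k]]|[D [E [-> /and3P[sD sE hDE]]]]].
- by exists [::], [::].
- rewrite mem_iota => kS /andP[sD sE]; exists (take k S), (drop k S).
  rewrite cat_take_drop; split=> //; rewrite /hook_split sD.
  have k0 : 0 < k by lia.
  have lk : k.-1 < size S by lia.
  move: sE; rewrite (drop_nth 0) // prednK // => sE.
  rewrite (path_sorted sE) /=; apply/implyP => _.
  have szk : size (take k S) = k by rewrite size_takel; lia.
  rewrite -size_eq0 szk -lt0n k0 -nth_last szk nth_take; last lia.
  exact: order_path_min ltn_trans sE.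
- case/lastP: D sD hDE => [|D p] sD hDE.
    by case: (E) hDE.
  apply/orP; right; apply/hasP; exists (size (rcons D p)).
    by rewrite mem_iota size_cat size_rcons; lia.
  rewrite take_size_cat // sD cat_rcons size_rcons drop_size_cat //=.
  rewrite (path_sortedE ltn_trans) sE andbT.
  by case: (E) hDE => // x E' /andP[_]; rewrite last_rcons.
Qed.

Lemma hook_split_unique D E D' E' : hook_split D E -> hook_split D' E' ->
  D ++ E = D' ++ E' -> E = E'.
Proof.
wlog le_DD' : D E D' E' / size D <= size D'.
  by move=> W h h' e; case/orP: (leq_total (size D) (size D')) => l;
    [|symmetry]; apply: (W _ _ _ _ l).
move=> /and3P[_ _ hE] /and3P[sD' _ _] e.
have eD : D' = D ++ drop (size D) D'.
  have -> : D = take (size D) D'.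
    by rewrite -(takel_cat E' le_DD') -e take_size_cat.
  by rewrite size_takel // cat_take_drop.
move: e; rewrite {1}eD -catA => /eqP; rewrite eqseq_cat // eqxx /= => /eqP eE.
case eF : (drop _ _) eD eE => [|f F] eD eE //.
move: hE; rewrite eE /= => /andP[D0 /andP[lf _]].
move: sD'; rewrite eD; case/lastP: (D) D0 lf => // D1 p _; rewrite last_rcons.
rewrite cat_rcons (sorted_pairwise geq_trans) pairwise_cat /=.
by move=> lf /and3P[_ _ /andP[/andP[+ _] _]]; lia.
Qed.

Lemma hook_split_uniq D E : hook_split D E -> uniq E.
Proof. by case/and3P => _ /(sorted_uniq ltn_trans ltnn). Qed.

(** * Steps of the walk *)

(** What may follow the initial run of the letter [j] in its row. *)
Definition is_tail (j : nat) (S : seq nat) : bool :=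
  all (fun x => 0 < x <= j) S && ((S == [::]) || (hook_word S && (head 0 S < j))).

(** Letters above [size c] no longer matter, so only the pairs [i], [i.+1] of
    letters up to [size c] are compared. *)
Definition is_step (c S : seq nat) : bool :=
  is_tail (size c) S &&
  all (fun i => ballot i (mult c i) (mult c i.+1) (rev S)) (iota 1 (size c).-1).

Definition next_state (c S : seq nat) : seq nat :=
  by_letter (size c).-1 (fun x => mult c x + count_mem x S).

Definition falling_part (c l e : seq nat) : seq nat :=
  dec_word (by_letter (size c).-1 (fun x => mult l x - mult c x - mult e x)).

(** A step is recovered from the next state [l] and from the multiplicities
    [e] of its rising part. *)
Definition step_word (c l e : seq nat) : seq nat :=
  falling_part c l e ++ rev (dec_word e).

(** The pairs [l], [e] that come from a step ([is_step_admissible],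
    [adm_is_step]). *)
Definition admissible (M : nat) (c l e : seq nat) : bool :=
  [&& l \in vecs (size c).-1 M, e \in vecs (size c) 2, sorted geq l,
      interlaces_add (head 0 c).+1 c l e & min_is_falling c l e].

Lemma bits_mult e x : all (fun x => x < 2) e -> mult e x < 2.
Proof.
move=> ae; rewrite /mult; have [lt|ge] := ltnP (size e - x) (size e).
  by move/(all_nthP 0): ae; apply.
by rewrite nth_default.
Qed.

Section Admissible.
Variables (M m : nat) (c l e : seq nat).
Hypotheses (sc : size c = m.+1) (adm : admissible M c l e).

Let sl : size l = m.
Proof. by case/and5P: adm => /size_vecs ->; rewrite sc. Qed.
Let se : size e = m.+1.
Proof. by case/and5P: adm => _ /size_vecs ->; rewrite sc. Qed.
Let be : all (fun x => x < 2) e.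
Proof. by case/and5P: adm => _ + _ _ _; rewrite mem_vecs => /andP[]. Qed.

Lemma adm_bounds x : 0 < x <= m ->
  mult l x <= mult c x.+1 + mult e x.+1 /\ mult c x + mult e x <= mult l x.
Proof.
case/and5P: adm => _ _ _ /interlaces_addP h _ xm.
by case: h; rewrite ?sc ?sl ?se // => _; apply.
Qed.

Lemma count_falling_part x : 0 < x <= m ->
  count_mem x (falling_part c l e) = mult l x - mult c x - mult e x.
Proof. by move=> xm; rewrite count_dec_word ?size_by_letter ?sc // mult_by_letter. Qed.

Lemma falling_part_letters x : x \in falling_part c l e -> 0 < x <= m.
Proof. by move/dec_word_letters; rewrite size_by_letter sc. Qed.

(** The smallest letter of the falling part, and all letters below it, are
    absent from the rising part: inductively [c] and [l] agree on the smaller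
    letters, and [min_is_falling] applies. *)
Lemma adm_min_letter x : 0 < x <= m.+1 ->
  (forall y, 0 < y < x -> y \notin falling_part c l e) ->
  forall y, 0 < y <= x -> mult e y = 0.
Proof.
move=> xm hx; elim/ltn_ind => y IH yx.
case/and5P: adm => _ _ _ _ /min_is_fallingP; rewrite sc sl se => /(_ erefl erefl).
apply; first by lia.
move=> z zy; have zx : 0 < z < x by lia.
have := hx z zx; rewrite -has_pred1 has_count -leqNgt leqn0.
rewrite count_falling_part; last lia.
have [_] : _ /\ _ := adm_bounds (x := z) ltac:(lia).
by rewrite IH; [move=> ? /eqP ?; lia|lia|lia].
Qed.

Lemma adm_hook_split : hook_split (falling_part c l e) (rev (dec_word e)).
Proof.
rewrite /hook_split dec_word_sorted rev_sorted dec_word_strict //=.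
apply/implyP => E0.
have mem_e x : x \in dec_word e -> mult e x != 0.
  move=> xe; rewrite -count_dec_word ?(dec_word_letters xe) //.
  by rewrite -lt0n -has_count has_pred1.
have D0 : falling_part c l e != [::].
  apply: contraNneq E0 => D0; rewrite -size_eq0 size_rev size_eq0.
  case eE : (dec_word e) => [//|x s]; have xe : x \in dec_word e by rewrite eE mem_head.
  have xm := dec_word_letters xe; have := mem_e x xe.
  rewrite se in xm; rewrite (adm_min_letter xm) ?leqnn ?andbT //; last lia.
  by move=> y _; rewrite D0.
rewrite D0 /=; apply/allP => x; rewrite mem_rev => xe.
set p := last 0 _; rewrite ltnNge; apply: contra (mem_e x xe) => le_xp.
have pD : p \in falling_part c l e.
  by move: D0; rewrite /p; case: (falling_part c l e) => // y s _; apply: mem_last.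
have pm := falling_part_letters pD; have xm := dec_word_letters xe.
apply/eqP; apply: (adm_min_letter (x := p)); try lia.
move=> y yp; apply/negP => yD.
have : p <= y; last by lia.
have := dec_word_sorted
  (by_letter (size c).-1 (fun x => mult l x - mult c x - mult e x)).
rewrite -/(falling_part c l e) /p; move: yD.
case/lastP: (falling_part c l e) => // s q; rewrite last_rcons.
rewrite (sorted_pairwise geq_trans) pairwise_rcons mem_rcons inE.
by case/orP => [/eqP->|ys /andP[/allP/(_ _ ys)]].
Qed.

Lemma next_state_word : next_state c (step_word c l e) = l.
Proof.
apply: mult_ext; rewrite size_by_letter sc ?sl // => x /= xm.
rewrite mult_by_letter ?sc // /step_word count_cat count_falling_part //.
rewrite count_rev count_dec_word; last by rewrite se; lia.
by have [_] := adm_bounds xm; lia.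
Qed.

Lemma adm_is_step : sorted geq c -> is_step c (step_word c l e).
Proof.
move=> dc; rewrite /is_step /is_tail sc; apply/andP; split; first (apply/andP; split).
- apply/allP => x; rewrite mem_cat mem_rev => /orP[/falling_part_letters|/dec_word_letters].
    by lia.
  by rewrite se.
- have : (step_word c l e == [::]) || hook_word (step_word c l e).
    by apply/hook_splitP; exists (falling_part c l e), (rev (dec_word e)); split=> //;
      exact: adm_hook_split.
  case/orP => [->//|hw]; rewrite hw /=; apply/orP; right.
  have /and3P[_ _] := adm_hook_split; rewrite /step_word.
  case eD : (falling_part c l e) => [|x s] /=; first by case: (rev _) => //= *.
  by have := @falling_part_letters x; rewrite eD mem_head => /(_ isT) /=; lia.
apply/allP => i; rewrite mem_iota => im; have {}im : 0 < i <= m by lia.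
rewrite /step_word rev_cat revK ballot_cat ballot_decr ?dec_word_strict // ballot_incr; last first.
  by rewrite rev_sorted; apply: dec_word_sorted.
rewrite count_rev count_falling_part // !count_dec_word; try lia.
have [h1 h2] := adm_bounds im.
suff : mult c i <= mult c i.+1 by lia.
move: dc; rewrite (sorted_pairwise geq_trans) => /(pairwiseP 0).
by rewrite /mult; apply; rewrite ?inE; lia.
Qed.

End Admissible.

Lemma interlaces_add_path b c l a : size a = size c -> size c = (size l).+1 ->
  interlaces_add b c l a -> path geq b l.
Proof.
elim: l b c a => //= l1 l IH b [|y c] [|a1 a] //= [sa] [sc].
by move=> /andP[/andP[h1 h2] /IH ->] //; rewrite (leq_trans h1 h2).
Qed.

(** Read backwards, the word is its rising part in decreasing order followed
    by its falling part in increasing order. The two ballot conditions become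
    [c + e] weakly decreasing and [l] interlacing [c + e]. *)
Lemma is_step_admissible M m c S : size c = m.+1 -> sorted geq c ->
  (head 0 c).+1 < M -> is_step c S ->
  exists l e, admissible M c l e /\ S = step_word c l e.
Proof.
move=> sc dc hM /andP[/andP[lS hS] /allP bS].
have [D [E [eS hf]]] : exists D E, S = D ++ E /\ hook_split D E.
  by apply/hook_splitP; case/orP: hS => [->//|/andP[->]]; rewrite orbT.
have /and3P[sD sE hDE] := hf.
have uE := hook_split_uniq hf.
pose e := by_letter m.+1 (fun x => count_mem x E).
have eE (x : nat) : 0 < x <= m.+1 -> mult e x = count_mem x E by apply: mult_by_letter.
have lD : all (fun x => 0 < x <= m) D.
  apply/allP => x xD; have := allP lS x; rewrite eS mem_cat xD sc => /(_ isT) h.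
  have : head 0 S < m.+1.
    by case/orP: hS => [/eqP S0|/andP[_]]; [rewrite S0|rewrite sc].
  have -> : head 0 S = head 0 D by rewrite eS; case: (D) xD.
  case: (D) sD xD => //= y s ys; rewrite inE => /orP[/eqP xy|xs].
    by rewrite /= -xy; move: h; clear; lia.
  have /allP/(_ _ xs) := order_path_min geq_trans ys.
  by rewrite /=; move: h; clear; lia.
have lE : all (fun x => 0 < x <= m.+1) E.
  by apply/allP => x xE; have := allP lS x; rewrite eS mem_cat xE orbT sc => /(_ isT).
have rE : rev (dec_word e) = E.
  have -> : dec_word e = rev E; last by rewrite revK.
  rewrite /e [RHS](@dec_word_unique _ m.+1).
  - by congr dec_word; apply: eq_map => x; rewrite count_rev.
  - by rewrite rev_sorted; apply: sub_sorted sE => x y /ltnW.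
  - by rewrite all_rev.
have bE : all (fun x => x < 2) e.
  by apply/allP => _ /mapP[x _ ->]; rewrite count_uniq_mem //; case: (x \in E).
have se : size e = m.+1 by rewrite size_by_letter.
clearbody e.
pose l := next_state c S.
have lE' (x : nat) : 0 < x <= m -> mult l x = mult c x + count_mem x S.
  by move=> xm; rewrite mult_by_letter ?sc.
have sl : size l = m by rewrite size_by_letter sc.
clearbody l.
have cS (x : nat) : count_mem x S = count_mem x D + count_mem x E by rewrite eS count_cat.
have bnd (x : nat) : 0 < x <= m ->
    mult l x <= mult c x.+1 + mult e x.+1 /\ mult c x + mult e x <= mult l x.
  move=> xm; have [x1 x2 x3] :
      [/\ 0 < x <= m.+1, 0 < x.+1 <= m.+1 & 1 <= x < 1 + m.+1.-1].
    by move: xm; clear=> ?; split; lia.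
  rewrite lE' // !eE // cS; split; last by clear; lia.
  have := bS x; rewrite mem_iota sc => /(_ x3).
  rewrite eS rev_cat ballot_cat => /andP[_].
  by rewrite ballot_incr ?rev_sorted // !count_rev; clear; lia.
have qc : interlaces_add (head 0 c).+1 c l e.
  apply/interlaces_addP; rewrite ?sc ?sl ?se //; split; last exact: bnd.
  have := bits_mult m.+1 bE.
  have -> : mult c m.+1 = head 0 c by rewrite /mult sc subnn nth0.
  by clear; lia.
have pl := interlaces_add_path (etrans se (esym sc)) (etrans sc (congr1 succn (esym sl))) qc.
exists l, e; split; last first.
  rewrite /step_word rE eS; congr (_ ++ _).
  rewrite [LHS](dec_word_unique sD lD) /falling_part sc; congr dec_word.
  apply/eq_in_map => x; rewrite mem_rev mem_iota => xm.
  have [x1 x2] : 0 < x <= m /\ 0 < x <= m.+1 by move: xm; clear; lia.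
  by rewrite lE' // eE // cS; clear; lia.
apply/and5P; split=> //.
- rewrite sc mem_vecs sl eqxx /=; apply/allP => x xl.
  by have /allP/(_ _ xl) := order_path_min geq_trans pl; rewrite /=; move: hM; clear; lia.
- by rewrite mem_vecs se sc eqxx.
- exact: path_sorted pl.
apply/min_is_fallingP; rewrite ?sc ?sl ?se // => x xm hx.
rewrite eE //; apply: count_mem0 => y yE; apply: contraTneq yE => -> {y}.
apply/negP => xE; have E0 : E != [::] by case: (E) xE.
move: hDE; rewrite E0 => /andP[D0 /allP/(_ _ xE) lx].
have pD : last 0 D \in D by case: (D) D0 => // y s _; apply: mem_last.
have pm := allP lD _ pD.
have := hx (last 0 D); rewrite lE' //.
have : 0 < count_mem (last 0 D) S by rewrite -has_count has_pred1 eS mem_cat pD.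
by move: pm lx; clear; lia.
Qed.

Definition steps (M : nat) (c : seq nat) : seq (seq nat) :=
  [seq step_word c p.1 p.2 |
    p <- [seq (l, e) | l <- vecs (size c).-1 M, e <- vecs (size c) 2]
    & admissible M c p.1 p.2].

Lemma steps_uniq M c : 0 < size c -> uniq (steps M c).
Proof.
case sc : (size c) => [//|m] _; rewrite map_inj_in_uniq.
  rewrite filter_uniq // allpairs_uniq ?vecs_uniq //.
  by move=> [a b] [a' b'] _ _ /= [-> ->].
move=> [l e] [l' e']; rewrite !mem_filter /= => /andP[a1 _] /andP[a2 _] eqw.
have el : l = l'.
  by rewrite -(next_state_word sc a1) eqw (next_state_word sc a2).
congr (_, _) => //; subst l'.
have := hook_split_unique (adm_hook_split sc a1) (adm_hook_split sc a2) eqw.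
move=> /(congr1 rev); rewrite !revK => eD.
case/and5P: a1 => _ /size_vecs se _ _ _; case/and5P: a2 => _ /size_vecs se' _ _ _.
apply: mult_ext; first by rewrite se se'.
move=> x xe; rewrite -!count_dec_word ?eD //; by rewrite ?se' -?se.
Qed.

Lemma mem_steps M c S : 0 < size c -> sorted geq c -> (head 0 c).+1 < M ->
  (S \in steps M c) = is_step c S.
Proof.
case sc : (size c) => [//|m] _ dc hM; apply/mapP/idP => [[[l e]]|].
  by rewrite mem_filter /= => /andP[a _] ->; apply: adm_is_step sc a dc.
case/(is_step_admissible sc dc hM) => l [e [a ->]]; exists (l, e) => //.
rewrite mem_filter a /=; apply/allpairsP; exists (l, e).
by case/and5P: a => ? ? _ _ _; split.
Qed.

(** By the parametrisation of steps it suffices to count the rising parts for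
    fixed [c] and [l], which is [sum_min_falling]. *)
Lemma sum_steps M m c (F : seq nat -> nat) : size c = m.+1 -> sorted geq c ->
  \sum_(S <- steps M c) F (next_state c S) =
  \sum_(l <- vecs m M | sorted geq l) \sum_(a <- vecs m 2 | interlaces_sub c l a) F l.
Proof.
move=> sc dc; rewrite big_map big_filter.
transitivity (\sum_(p <- [seq (l, e) | l <- vecs m M, e <- vecs m.+1 2])
   if admissible M c p.1 p.2 then F p.1 else 0).
  rewrite sc -big_mkcond; apply: eq_bigr => -[l e] a.
  by rewrite (next_state_word sc a).
rewrite big_allpairs_dep [RHS]big_mkcond; apply: eq_big_vecs => l sl la _ /=.
have lv : l \in vecs m M by rewrite mem_vecs sl eqxx.
case: ifP => dl; last first.
  by rewrite big1_seq // => e _; rewrite /admissible dl !andbF.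
case: c sc dc => // x c [sc] dc.
rewrite -big_mkcond.
have [pl|npl] := boolP (path geq x.+1 l); last first.
  rewrite big1_seq => [|a /andP[+ _]]; last first.
    case/and5P=> _ /size_vecs sa _ /(interlaces_add_path sa); rewrite (negbTE npl).
    by rewrite /= sc sl => /(_ erefl).
  rewrite big1_seq // => a /andP[+ av].
  case: l sl dl npl {la lv} => [|y l] sl /= dl; first by [].
  rewrite dl andbT => npl; case: a av => [|a1 a] //.
  by rewrite mem_vecs => /andP[_ /= /andP[a2 _]] /andP[h _]; lia.
have := sum_min_falling dc pl (etrans sc (esym sl)) (leqnSn x).
rewrite leqnn mul1n sc => e1.
transitivity ((\sum_(a <- vecs m 2 | interlaces_sub (x :: c) l a) 1) * F l); last first.
  by rewrite big_distrl /=; apply: eq_bigr => a _; rewrite mul1n.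
rewrite -e1 big_distrl /= big_seq_cond [RHS]big_seq_cond.
apply: eq_big => [a|a _]; last by rewrite mul1n.
by rewrite /admissible /= sc lv dl; case: (a \in _).
Qed.

(** * Walks and their weights *)

Fixpoint chain (c : seq nat) (us : seq (seq nat)) : bool :=
  if us is u :: us' then
    [&& size c == size us, is_step c u & chain (next_state c u) us']
  else c == [::].

Fixpoint chains (M m : nat) (c : seq nat) : seq (seq (seq nat)) :=
  if m is m'.+1 then
    [seq u :: us | u <- steps M c, us <- chains M m' (next_state c u)]
  else [:: [::]].

Lemma next_state_sorted c u : 0 < size c -> sorted geq c -> is_step c u ->
  sorted geq (next_state c u) /\ head 0 (next_state c u) <= (head 0 c).+1.
Proof.
case sc : (size c) => [//|m] _ dc sS.
have [l [e [a ->]]] := is_step_admissible sc dc (ltnSn _) sS.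
rewrite (next_state_word sc a); case/and5P: a.
move=> /size_vecs sl /size_vecs se dl /(interlaces_add_path se); rewrite sl sc.
move=> /(_ erefl) pl _; split => //.
by case: (l) pl => //= y s /andP[].
Qed.

Lemma size_next_state c u : size (next_state c u) = (size c).-1.
Proof. exact: size_by_letter. Qed.

Lemma mem_chains M m c us : size c = m -> sorted geq c -> head 0 c + m < M ->
  (us \in chains M m c) = chain c us.
Proof.
elim: m c us => [|m IH] c us sc dc hM.
  by case: c sc {dc hM} => // _; case: us.
have c0 : 0 < size c by rewrite sc.
have hM1 : (head 0 c).+1 < M by move: hM; clear; lia.
have step u : is_step c u -> forall us', (us' \in chains M m (next_state c u)) =
    chain (next_state c u) us'.
  move=> sS us'; have [d h] := next_state_sorted c0 dc sS.
  by rewrite IH ?size_next_state ?sc //; move: h hM; clear; lia.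
apply/idP/idP => [/allpairsPdep[u [us' [+ + ->]]]|].
  rewrite mem_steps // => sS; rewrite step // => h /=.
  rewrite sS h andbT andbT sc eqSS eq_sym.
  have {}h : chain (next_state c u) us' := h.
  case: us' h => [/eqP e|u' us' /= /and3P[/eqP <- _ _]].
    by rewrite -[m]/(m.+1.-1) -sc -(size_next_state c u) e.
  by rewrite size_next_state sc.
case: us => [|u us'] /=; first by move/eqP => c1; rewrite c1 in sc.
case/and3P=> _ sS h; apply: allpairs_f_dep; first by rewrite mem_steps.
by rewrite step.
Qed.

Lemma chains_uniq M m c : size c = m -> uniq (chains M m c).
Proof.
elim: m c => //= m IH c sc; apply: allpairs_uniq_dep => /=.
- by rewrite steps_uniq ?sc.
- by move=> u _; rewrite IH // size_next_state sc.
- by move=> [a b] [a' b'] _ _ /= [-> ->].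
Qed.

Section Weight.
Variables (W : zmodType) (X : nat -> W) (M : nat) (phi : W -> nat).

(** Each letter is counted at the stage where it is dropped from the state,
    rather than when it is added. *)
Fixpoint state_weight (c : seq nat) (us : seq (seq nat)) : W :=
  if us is u :: us' then
    (drop_weight X c (next_state c u) + state_weight (next_state c u) us')%R
  else 0%R.

Lemma sum_chains m c w : size c = m -> sorted geq c -> head 0 c + m < M ->
  \sum_(us <- chains M m c) phi (w + state_weight c us)%R = strip_sum X M phi m c w.
Proof.
elim: m c w => [|m IH] c w sc dc hM; first by rewrite /= big_seq1 addr0.
have c0 : 0 < size c by rewrite sc.
have hM1 : (head 0 c).+1 < M by move: hM; clear; lia.
rewrite /= big_allpairs_dep /=.
rewrite -(sum_steps M (fun l => strip_sum X M phi m l (w + drop_weight X c l)%R) sc dc).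
rewrite big_seq [RHS]big_seq; apply: eq_bigr => u; rewrite mem_steps // => sS.
have [d h] := next_state_sorted c0 dc sS.
rewrite -IH ?size_next_state ?sc //; last by move: h hM; clear; lia.
by apply: eq_bigr => us _; rewrite addrA.
Qed.

Fixpoint tails_weight (us : seq (seq nat)) : W :=
  if us is u :: us' then
    (\sum_(x <- u) (X x - X (size us)) + tails_weight us')%R
  else 0%R.

Lemma sum_letters (m : nat) (u : seq nat) (f : nat -> W) :
  all (fun x => 0 < x <= m) u ->
  (\sum_(x <- u) f x = \sum_(1 <= x < m.+1) f x *+ count_mem x u)%R.
Proof.
elim: u => [|y u IH] /=; first by rewrite big_nil big1.
move=> /andP[ym /IH e]; rewrite big_cons e.
rewrite [RHS](eq_bigr (fun x => (f x *+ (y == x) + f x *+ count_mem x u)%R));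
  last by move=> x _; rewrite mulrnDr.
rewrite big_split /=; congr (_ + _)%R.
rewrite (bigD1_seq y) ?iota_uniq ?mem_index_iota //= eqxx big1 ?addr0 //.
by move=> x /negbTE; rewrite eq_sym => ->.
Qed.

Lemma sumn_mult c (Y : W) :
  (Y *+ sumn c = \sum_(1 <= x < (size c).+1) Y *+ mult c x)%R.
Proof.
elim: c => [|y c IH] /=; first by rewrite big_geq.
rewrite big_nat_recr //= mult_head addnC mulrnDr IH; congr (_ + _)%R.
by apply: eq_big_nat => x /andP[_ xc]; rewrite mult_cons.
Qed.

(** Regrouping the contributions by letter: those of the initial state, and
    for each letter of [u_j] its own weight minus the weight of [j]. *)
Lemma state_weight_letters c us : chain c us ->
  (state_weight c us = \sum_(1 <= x < (size c).+1) X x *+ mult c x + tails_weight us)%R.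
Proof.
elim: us c => [|u us IH] c /=.
  by move/eqP => ->; rewrite big_geq // addr0.
case/and3P => /eqP sc /andP[/andP[lu _] _] /IH ->.
rewrite addrA [RHS]addrA; congr (_ + _)%R.
rewrite (sum_letters _ lu) /drop_weight !sumn_mult size_next_state sc /=.
rewrite !(big_nat_recr (size us).+1) //= subrr mul0rn addr0.
rewrite [RHS]addrAC [LHS]addrAC -[LHS]addrA -sumrN [LHS]addrAC; congr (_ + _)%R.
rewrite -!big_split /=; apply: eq_big_nat => x xm.
rewrite mult_by_letter ?sc // !mulrnDr mulrnBl.
rewrite opprD [X in (_ + X)%R = _]addrACA [LHS]addrA.
by rewrite [X in (X + _)%R = _]addrCA subrr addr0.
Qed.
End Weight.

(** * Rows of dual marginally large tableaux *)

(** The [j]-run is one longer than the row below, as marginal largeness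
    demands; rows are listed from the largest letter [j]. *)
Fixpoint tableau_of (us : seq (seq nat)) : seq (seq nat) :=
  if us is u :: us' then
    (nseq (size (head [::] (tableau_of us'))).+1 (size us) ++ u) :: tableau_of us'
  else [::].

Fixpoint are_tails (us : seq (seq nat)) : bool :=
  if us is u :: us' then is_tail (size us) u && are_tails us' else true.

Lemma size_tableau_of us : size (tableau_of us) = size us.
Proof. by elim: us => //= u us ->. Qed.

Lemma hook_turnP (u : seq nat) :
  reflect (exists k : nat,
     [/\ 0 < k <= size u, sorted geq (take k u) & sorted ltn (drop k.-1 u)])
    (hook_word u).
Proof.
apply: (iffP hasP) => [[k ku /andP[h1 h2]]|[k [ku h1 h2]]]; exists k => //.
- by move: ku; rewrite mem_iota add1n ltnS.
- by rewrite mem_iota add1n ltnS.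
- by rewrite h1.
Qed.

Lemma hook_suffix (v u : seq nat) :
  u != [::] -> hook_word (v ++ u) -> hook_word u.
Proof.
move=> u0 /hook_turnP[k []]; rewrite size_cat => kS h1 h2.
have su : 0 < size u by rewrite lt0n size_eq0.
apply/hook_turnP; have [le_kv|lt_vk] := leqP k (size v).
  exists 1; rewrite su drop0; split=> //; first by case: (u) => //= x s; rewrite take0.
  move: h2; rewrite drop_cat; case: ltnP => [lt|ge].
    rewrite (sorted_pairwise ltn_trans) pairwise_cat => /and3P[_ _].
    by rewrite -(sorted_pairwise ltn_trans).
  by have -> : k.-1 - size v = 0; [lia | rewrite drop0].
exists (k - size v); split; first by lia.
  move: h1; rewrite take_cat ltnNge (ltnW lt_vk) /=.
  rewrite (sorted_pairwise geq_trans) pairwise_cat => /and3P[_ _].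
  by rewrite -(sorted_pairwise geq_trans).
move: h2; rewrite drop_cat ltnNge (_ : size v <= k.-1) /=; last lia.
by rewrite (_ : (k - size v).-1 = k.-1 - size v) //; lia.
Qed.

(** An ascent can only occur after the turning letter. *)
Lemma hook_asc (v : seq nat) (y x : nat) (z : seq nat) :
  hook_word (v ++ y :: x :: z) -> y < x -> path ltn x z.
Proof.
move=> /(@hook_suffix v (y :: x :: z) isT) /hook_turnP[[|[|k]]] [] //=.
  by move=> _ _ /andP[].
by move=> _ /andP[h _] _ ?; exfalso; move: h; lia.
Qed.

Lemma hook_cons (x : nat) (s : seq nat) :
  hook_word s -> head 0 s <= x -> hook_word (x :: s).
Proof.
move=> /hook_turnP[[|k] [] // kS h1 h2] hx; apply/hook_turnP; exists k.+2.
split=> //; case: s kS h1 h2 hx => //= y s _ -> _ hx.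
by rewrite hx.
Qed.

Lemma hook_run (a j : nat) (u : seq nat) :
  0 < a -> is_tail j u -> hook_word (nseq a j ++ u).
Proof.
move=> a0 /andP[/allP lu hu].
have [D [E [eu /and3P[sD sE hDE]]]] : exists D E, u = D ++ E /\ hook_split D E.
  by apply/hook_splitP; case/orP: hu => [->//|/andP[->]]; rewrite orbT.
have : (nseq a j ++ u == [::]) || hook_word (nseq a j ++ u).
  apply/hook_splitP; exists (nseq a j ++ D), E; rewrite eu catA; split=> //.
  apply/and3P; split=> //.
    rewrite (sorted_pairwise geq_trans) pairwise_cat -!(sorted_pairwise geq_trans).
    rewrite sD andbT; apply/andP; split.
      apply/allrelP => x y /nseqP[-> _] yD; have := lu y.
      by rewrite eu mem_cat yD => /(_ isT) /andP[].
    by elim: (a) => // -[|b] //= ->; rewrite leqnn.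
  apply/implyP => /(implyP hDE) /andP[D0 lE]; case: (D) D0 lE => // x s _.
  by rewrite last_cat /= => ->; case: (a).
by case: (a) a0.
Qed.

Lemma subseq_cat_split (w s1 s2 : seq nat) : subseq w (s1 ++ s2) ->
  exists w1 w2 : seq nat, [/\ w = w1 ++ w2, subseq w1 s1 & subseq w2 s2].
Proof.
case/subseqP => m sm ->; exists (mask (take (size s1) m) s1).
exists (mask (drop (size s1) m) s2); rewrite !mask_subseq; split=> //.
by rewrite -mask_cat ?cat_take_drop // size_takel // sm size_cat leq_addr.
Qed.

(** A hook subword that uses both the row [r] below and the run of [j]'s has
    an ascent to [j] and must stop there, so it has at most [(size r).+1]
    letters. A subword that avoids [r] lies in the row itself, and one that
    avoids the run is short because the run is longer than [r]. *)
Lemma run_rows_maximal (j : nat) (r u w : seq nat) :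
  all (fun x => x < j) r -> all (fun x => x <= j) u ->
  subseq w (r ++ nseq (size r).+1 j ++ u) -> hook_word w ->
  size w <= size (nseq (size r).+1 j ++ u).
Proof.
move=> lr lu /subseq_cat_split[w1 [w' [-> s1 /subseq_cat_split[w2 [w3 [-> s2 s3]]]]]].
rewrite !size_cat size_nseq => hw.
have := (size_subseq s1, size_subseq s2, size_subseq s3); rewrite size_nseq.
move=> -[[z1 z2] z3].
case/lastP: w1 s1 hw z1 => [|v y] s1 hw z1; first exact: (leq_add z2 z3).
case: w2 s2 hw z2 => [|x w2] s2 hw z2.
  exact: (leq_add (leqW z1) z3).
have lt_yj : y < j.
  by apply: (allP lr); apply: (mem_subseq s1); rewrite mem_rcons mem_head.
have /nseqP[ex _] : x \in nseq (size r).+1 j.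
  by apply: (mem_subseq s2); rewrite mem_head.
subst x; move: hw; rewrite cat_rcons cat_cons => /hook_asc /(_ lt_yj).
rewrite (path_sortedE ltn_trans) => /andP[lt_j _].
have : w2 ++ w3 = [::].
  case e : (w2 ++ w3) lt_j => [//|z t] /= /andP[lt_jz _].
  have : z \in w2 ++ w3 by rewrite e mem_head.
  rewrite mem_cat => /orP[zw|zw].
    have /nseqP[ez _] : z \in nseq (size r).+1 j.
      by apply: (mem_subseq s2); rewrite inE zw orbT.
    by move: lt_jz; rewrite ez ltnn.
  by have := allP lu _ (mem_subseq s3 zw); lia.
move=> /eqP; rewrite -size_eq0 size_cat addn_eq0 => /andP[/eqP e2 /eqP e3].
by rewrite [size (_ :: _)]/= e2 e3 addn0 addn1 (leq_trans _ (leq_addr _ _)).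
Qed.

Lemma tableau_of_letters us : are_tails us ->
  all (all (fun x => 0 < x <= size us)) (tableau_of us).
Proof.
elim: us => //= u us IH /andP[/andP[lu _] /IH h].
rewrite all_cat lu andbT all_nseq /= leqnn orbT /= (sub_all _ h) // => r.
by apply: sub_all => x; lia.
Qed.

Lemma head_tableau_of_letters us : are_tails us ->
  all (fun x => 0 < x <= size us) (head [::] (tableau_of us)).
Proof. by move/tableau_of_letters; case: (tableau_of us) => //= r T /andP[]. Qed.

Lemma tableau_of_sdt n us :
  are_tails us -> size us <= n -> is_sdt n (tableau_of us).
Proof.
elim: us => [|u us IH] ok le_n.
  by split=> // k; rewrite ltn0.
have {ok} [okc [ok oks]] : are_tails (u :: us) /\ is_tail (size us).+1 u /\ are_tails us.
  by split=> //; case/andP: ok.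
have [h1 h2 h3 h4] := IH oks (ltnW le_n).
split.
- have {}le_n : (size us).+1 <= n := le_n.
  apply: sub_all (tableau_of_letters okc) => r; apply: sub_all => x /=; lia.
- rewrite /= size_cat size_nseq /=; case: (tableau_of us) h2 => //= r T ->.
  by rewrite andbT ltnS leq_addr.
- by have /= -> := hook_run (ltn0Sn (size (head [::] (tableau_of us)))) ok.
move=> [|k] /= lt_k w sw hw; last exact: h4.
have e : trow (tableau_of us) 0 = head [::] (tableau_of us) by case: (tableau_of us).
have sw' : subseq w (head [::] (tableau_of us) ++
    nseq (size (head [::] (tableau_of us))).+1 (size us).+1 ++ u) by rewrite -{1}e.
apply: run_rows_maximal sw' hw.
- by apply: sub_all (head_tableau_of_letters oks) => x; lia.
- by case/andP: ok => lu _; apply: sub_all lu => x; lia.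
Qed.

Lemma dmlP n T :
  reflect (size T = n /\ forall k, k < n ->
             initial_run (n - k) (trow T k) = (size (trow T k.+1)).+1)
          (dual_marginally_large n T).
Proof.
apply: (iffP and3P) => [[/eqP sT _ /allP h]|[sT h]]; split=> //; try exact/eqP.
- move=> k lt_kn; have := h (n - k); rewrite mem_iota subKn ?(ltnW lt_kn) //.
  by move=> /(_ ltac:(lia)) /eqP.
- apply/(all_nthP [::]) => k; rewrite sT => lt_kn; have := h k lt_kn.
  by rewrite /trow; case: (nth _ _ k).
- apply/allP => i; rewrite mem_iota => ik; have := h (n - i) ltac:(lia).
  by rewrite subKn; [move=> ->|lia].
Qed.

Lemma initial_run_nseq j a u : head j.+1 u != j ->
  initial_run j (nseq a j ++ u) = a.
Proof.
rewrite /initial_run find_cat size_nseq has_nseq eqxx andbF => h.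
case: u h => [|x u] /= h; first by rewrite addn0.
by rewrite h addn0.
Qed.

Lemma tableau_of_dml us :
  are_tails us -> dual_marginally_large (size us) (tableau_of us).
Proof.
move=> ok; apply/dmlP; split; first exact: size_tableau_of.
elim: us ok => //= u us IH /andP[ok oks] [_|k lt_k].
  have h0 : head (size us).+2 u != (size us).+1.
    case/andP: ok => _ /orP[/eqP->|/andP[_]] /=; first by rewrite neq_ltn ltnSn orbT.
    by case: (u) => [|x u'] /= lt_x; rewrite ?neq_ltn ?lt_x ?ltnSn ?orbT.
  rewrite subn0.
  have -> := initial_run_nseq (size (head [::] (tableau_of us))).+1 h0.
  by case: (tableau_of us).
by rewrite subSS; apply: IH.
Qed.

Fixpoint tails_of (T : seq (seq nat)) : seq (seq nat) :=
  if T is r :: T' then drop (initial_run (size T) r) r :: tails_of T' else [::].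

Lemma size_tails_of T : size (tails_of T) = size T.
Proof. by elim: T => //= r T ->. Qed.

Lemma initial_runE j r :
  r = nseq (initial_run j r) j ++ drop (initial_run j r) r.
Proof.
rewrite /initial_run; elim: r => //= x r IH; case: eqP => [->|//] /=.
by rewrite -IH.
Qed.

Lemma tails_ofK T :
  (forall k, k < size T ->
     initial_run (size T - k) (trow T k) = (size (trow T k.+1)).+1) ->
  tableau_of (tails_of T) = T.
Proof.
elim: T => //= r T IH h; rewrite IH; last by move=> k lt_k; apply: (h k.+1).
congr (_ :: _).
rewrite size_tails_of [in RHS](initial_runE (size T).+1 r).
have -> : initial_run (size T).+1 r = (size (head [::] T)).+1.
  by rewrite -[(size T).+1]subn0 (h 0 isT); case: (T).
by [].
Qed.

(** The row with leading letter [j] has no letter above [j]: put in front of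
    the row above, it would give a hook subword longer than that row. *)
Lemma sdt_tails n T : SDT_minf n T ->
  exists us, [/\ size us = n, are_tails us & T = tableau_of us].
Proof.
case=> -[lT _ hT mT] /dmlP[sT rT]; exists (tails_of T).
rewrite size_tails_of sT tails_ofK ?sT //; split=> //.
have hrow k : k < n -> hook_word (trow T k).
  by move=> lt_k; apply: (all_nthP [::] hT); rewrite sT.
have rowE k : k < n -> trow T k = nseq (size (trow T k.+1)).+1 (n - k) ++
    drop (size (trow T k.+1)).+1 (trow T k).
  by move=> lt_k; rewrite -rT // -initial_runE.
have lrow k : k < n -> all (fun x => 0 < x <= n - k) (trow T k).
  move=> lt_k; have := all_nthP [::] lT k; rewrite sT => /(_ lt_k) /allP l0.
  apply/allP => x xk; have /andP[-> le_xn] := l0 x xk; rewrite /=.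
  case: k lt_k xk {l0} => [|k] lt_k xk; first by rewrite subn0.
  rewrite leqNgt; apply/negP => lt_x.
  have lt_k' : k < n := ltnW lt_k.
  have := mT k; rewrite sT => /(_ lt_k' (x :: trow T k)).
  rewrite -cat1s cat_subseq ?sub1seq // /= ltnn => /(_ isT) h.
  suff : false by []; apply: h; apply: hook_cons; first exact: hrow.
  by rewrite (rowE k) //=; lia.
have tok k : k < n -> is_tail (n - k) (drop (initial_run (n - k) (trow T k)) (trow T k)).
  move=> lt_k; have := initial_runE (n - k) (trow T k).
  have := lrow k lt_k; have := hrow k lt_k.
  set u := drop _ _ => hw lw e; move: hw lw; rewrite e => hw.
  rewrite all_cat /is_tail => /andP[_ lu]; rewrite lu /=.
  have [//|u0] := eqVneq u [::]; rewrite (hook_suffix u0 hw) /=.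
  have : head 0 u != n - k.
    move: u0; rewrite /u /initial_run; set p := (fun x => _).
    have [hp _|] := boolP (has p (trow T k)); last first.
      by move/hasNfind => ->; rewrite drop_size.
    by rewrite -nth0 nth_drop addn0; exact: (nth_find 0 hp).
  case: u u0 lu {e hw} => //= x u _ /andP[/andP[_ le_x] _] /eqP ne.
  by lia.
elim: (T) n sT tok {lT hT mT rT hrow rowE lrow} => //= r T' IH n sT tok.
rewrite size_tails_of sT; apply/andP; split.
  by have := tok 0; rewrite subn0; apply; rewrite -sT.
case: n sT tok => // n [sT] tok; apply: (IH n sT) => k lt_k.
exact: (tok k.+1 lt_k).
Qed.

Lemma tails_sdt us : are_tails us -> SDT_minf (size us) (tableau_of us).
Proof. by move=> ok; split; [exact: tableau_of_sdt | exact: tableau_of_dml]. Qed.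

Lemma tableau_of_inj us vs : tableau_of us = tableau_of vs -> us = vs.
Proof.
elim: us vs => [|u us IH] [|v vs] // h.
have eus : us = vs by apply: IH; exact: (congr1 behead h).
have /eqP := congr1 (head [::]) h.
by rewrite eus [_ == _]eqseq_cat //= => /andP[_ /eqP->].
Qed.

(** * The signature rule *)

Definition reading_word (T : seq (seq nat)) : seq nat := flatten [seq rev r | r <- T].

Lemma entries_rd T : map (entry T) (rd T) = reading_word T.
Proof.
rewrite /rd map_flatten /reading_word -map_comp; congr flatten.
rewrite -[in RHS](mkseq_nth [::] T) /mkseq -map_comp; apply: eq_map => k /=.
by rewrite -map_comp /entry /= map_rev -/(mkseq _ _) mkseq_nth.
Qed.

Section Brackets.
Variables (i : nat) (T : seq (seq nat)).
Let e := entry T.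
Let letter b := (e b == i) || (e b == i.+1).

Lemma ballot_shift a b w : ballot i a.+1 b.+1 w = ballot i a b w.
Proof. by elim: w a b => [|x w IH] a b //=; rewrite !addSn IH. Qed.

Lemma ballot_filter a b s :
  ballot i a b (map e (filter letter s)) = ballot i a b (map e s).
Proof.
elim: s a b => //= x s IH a b; case lx: (letter x) => /=; first by rewrite IH.
move: lx; rewrite IH /letter => /norP[/negbTE-> /negbTE->]; rewrite !addn0.
by case: (leqP a b) => // lt; apply/negP => /ballot_le; rewrite leqNgt lt.
Qed.

Lemma ballot_remove_pair a b s :
  ballot i a b (map e (remove_pair i T s)) = ballot i a b (map e s).
Proof.
elim: s a b => // x [|y s] IH a b //; rewrite /=; case: ifP => [/andP[/eqP ex /eqP ey]|_].
  rewrite /e ex ey eqxx.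
  have -> : i.+1 == i = false by apply/eqP; lia.
  have -> : i == i.+1 = false by apply/eqP; lia.
  rewrite eqxx !addn0 !addn1 ballot_shift.
  case: (leqP a b) => [le|lt] /=; first by rewrite (leqW le).
  by apply/negP => /ballot_le; rewrite leqNgt lt.
by rewrite /= IH.
Qed.

Lemma all_remove_pair s : all letter s -> all letter (remove_pair i T s).
Proof.
elim: s => // x [|y s] IH //; rewrite /=; case: ifP => [_ /and3P[]//|_].
by move=> /andP[lx /IH h]; rewrite /= lx h.
Qed.

Lemma remove_pair_size s :
  remove_pair i T s = s \/ size (remove_pair i T s) < size s.
Proof.
elim: s => [|x [|y s] IH]; [by left|by left|].
rewrite /=; case: ifP => _; first by right; rewrite /=; lia.
by case: IH => h; [left; congr (_ :: _)|right].
Qed.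

Lemma iter_remove_pair k s : size s <= k ->
  remove_pair i T (iter k (remove_pair i T) s) = iter k (remove_pair i T) s.
Proof.
elim: k s => [|k IH] s; first by case: s.
move=> sk; rewrite iterSr; case: (remove_pair_size s) => h.
  by rewrite h; elim: (k) => //= k1 e1; rewrite !e1.
by apply: IH; move: h sk; lia.
Qed.

(** Without an adjacent pair [i.+1], [i], the word consists of letters [i]
    followed by letters [i.+1], and a letter [i] at its head violates the
    ballot condition. *)
Lemma reduced_ballot s : all letter s -> remove_pair i T s = s ->
  ballot i 0 0 (map e s) = (filter (fun b => e b == i) s == [::]).
Proof.
have rest x s1 : e x == i.+1 -> all letter s1 -> remove_pair i T (x :: s1) = x :: s1 ->
    filter (fun b => e b == i) s1 = [::].
  elim: s1 x => //= y s1 IH x ex /andP[ly ls].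
  rewrite -/(e x) -/(e y) ex /=; case: eqP => [_ /(congr1 size) /=|ne [h]].
    lia.
  by apply: (IH y) => //; move: ly; rewrite /letter (introF eqP ne).
case: s => //= x s /andP[lx ls] red; rewrite !add0n.
move: lx; rewrite /letter; case: eqP => [ex _|ne /= ex].
  rewrite ex; apply/negP => /ballot_le.
  by have -> : i == i.+1 = false by apply/eqP; lia.
have s0 := rest x s ex ls red; rewrite s0 eqxx.
apply: ballot_notin; last by [].
rewrite count_map -size_filter (eq_filter (a2 := fun b => e b == i)) //.
by rewrite s0.
Qed.

(** Cancelling pairs does not affect the ballot condition. *)
Lemma f_even_None n : (f_even n i T = None) <-> ballot i 0 0 (reading_word T).
Proof.
rewrite -entries_rd -ballot_filter -/(rdi i T).
have -> : ballot i 0 0 (map e (rdi i T)) = ballot i 0 0 (map e (rdi_bar i T)).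
  rewrite /rdi_bar; elim: (size _) => //= k ->; by rewrite ballot_remove_pair.
rewrite reduced_ballot.
- by rewrite /f_even -/e; case: [seq b <- _ | _] => //= b s; split.
- rewrite /rdi_bar; elim: (size _) => [|k IH] /=; first exact: filter_all.
  exact: all_remove_pair.
- exact: iter_remove_pair.
Qed.

End Brackets.

(** A ballot word for the letters 1 and 2 cannot begin with 1. *)
Lemma f_odd_None n T : ballot 1 0 0 (reading_word T) -> f_odd n T = None.
Proof.
rewrite -entries_rd -ballot_filter -/(rdi 1 T) /f_odd.
have := filter_all (fun b => (entry T b == 1) || (entry T b == 2)) (rd T).
rewrite -/(rdi 1 T); case: (rdi 1 T) => //= b s /andP[/orP[/eqP->|->] _] //.
by move/ballot_le.
Qed.

Lemma lowest_weightP n T : 2 <= n ->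
  lowest_weight n T <->
  SDT_minf n T /\ forall i, 0 < i < n -> ballot i 0 0 (reading_word T).
Proof.
move=> n2; split=> [[sT h]|[sT h]]; split=> //.
  by move=> i ni; apply/(f_even_None i T n); exact: (h (Even ni)).
case=> [i ni|]; first exact/f_even_None/h.
by apply: f_odd_None; apply: h; rewrite n2.
Qed.

(** * Lowest weight tableaux as walks *)

Lemma count_rword_tableau_of i us :
  are_tails us -> size us < i -> count_mem i (reading_word (tableau_of us)) = 0.
Proof.
move=> ok lt; apply: count_mem0 => y /flattenP[_ /mapP[r rT ->]].
rewrite mem_rev => yr; have := allP (allP (tableau_of_letters ok) r rT) y yr.
by move=> h; apply/eqP; lia.
Qed.

(** Let [j = size us] be the largest letter. For [i < j.-1] the run of [j]'s
    is invisible and the condition passes to the next state. For [i = j.-1]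
    all the remaining letters [i] lie in the row below, which is shorter than
    the run of [j]'s. *)
Lemma ballot_chain c us : size c = size us -> are_tails us ->
  (forall i, 0 < i < size us ->
     ballot i (mult c i) (mult c i.+1) (reading_word (tableau_of us))) <-> chain c us.
Proof.
elim: us c => [|u us IH] c sc ok.
  split=> [_|_ i]; [by apply/eqP/size0nil|by rewrite ltn0 andbF].
have {ok} [ok oks] : is_tail (size us).+1 u /\ are_tails us by case/andP: ok.
set j := (size us).+1 in ok sc *.
set r := head [::] (tableau_of us).
have wE : reading_word (tableau_of (u :: us)) =
    rev u ++ nseq (size r).+1 j ++ reading_word (tableau_of us).
  have -> : reading_word (tableau_of (u :: us)) =
    rev (nseq (size r).+1 j ++ u) ++ reading_word (tableau_of us) by [].
  by rewrite rev_cat rev_nseq -catA.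
have nE x : x != j -> count_mem x (nseq (size r).+1 j) = 0.
  by move=> ne; rewrite count_nseq /= eq_sym (negbTE ne).
have sn : size (next_state c u) = size us by rewrite size_next_state sc.
have [IH1 IH2] := IH (next_state c u) sn oks.
have nextE x : 0 < x <= size us -> mult (next_state c u) x = mult c x + count_mem x u.
  by move=> xs; rewrite mult_by_letter ?sc.
have run_ball i a b : 0 < i <= size us -> a <= b -> ballot i a b (nseq (size r).+1 j).
  by move=> si le_ab; apply: ballot_notin => //; apply: nE; rewrite /j; lia.
have -> : chain c (u :: us) = is_step c u && chain (next_state c u) us.
  by rewrite /= -/j sc eqxx.
rewrite wE; split=> [h|/andP[/andP[_ /allP hu] /IH2 h] i ij].
  apply/andP; split.
    rewrite /is_step sc ok; apply/allP => i; rewrite mem_iota /j => ij.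
    have /h : 0 < i < size (u :: us) by move: ij; clear => /=; lia.
    by rewrite ballot_cat => /andP[].
  apply: IH1 => i si.
  have /h : 0 < i < size (u :: us) by move: si; clear=> /=; lia.
  rewrite !ballot_cat => /and3P[_ _].
  rewrite !nE ?addn0 ?count_rev ?nextE //; try by rewrite /j; move: si; clear; lia.
have bu : ballot i (mult c i) (mult c i.+1) (rev u).
  by apply: hu; rewrite mem_iota sc /j; move: ij => /=; clear; lia.
have lu := ballot_count bu; rewrite !ballot_cat bu run_ball // !andTb.
have [lt_i|ge_i] := ltnP i (size us).
  have i0 : 0 < i by case/andP: ij.
  have := h i; rewrite i0 lt_i => /(_ isT).
  by rewrite !nextE ?i0 ?(ltnW lt_i) // !nE ?addn0 ?count_rev //;
    rewrite /j; move: lt_i; clear; lia.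
have ei : i = size us by move: ij ge_i; clear => /=; lia.
have ne : i != j by rewrite ei /j neq_ltn ltnSn.
have ej : i.+1 = j by rewrite ei.
have : count_mem i (reading_word (tableau_of us)) <= size r.
  rewrite ei /r; case: (us) oks => [|v vs] // /andP[_ oks'].
  have -> : reading_word (tableau_of (v :: vs)) =
    rev (head [::] (tableau_of (v :: vs))) ++ reading_word (tableau_of vs) by [].
  by rewrite count_cat count_rev [X in _ + X]count_rword_tableau_of ?addn0 ?count_size.
move: lu; rewrite ej => lu cr; apply: ballot_few; rewrite nE // addn0.
rewrite [X in _ <= _ + X]count_nseq /= eqxx mul1n.
by apply: leq_add => //; apply: leq_trans cr _.
Qed.

Lemma chain_tails c us : chain c us -> are_tails us /\ size c = size us.
Proof.
elim: us c => [|u us IH] c /=; first by move/eqP->.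
by case/and3P=> /eqP sc /andP[tok _] /IH[-> _]; rewrite -sc tok.
Qed.

Lemma mult_nseq0 n x : mult (nseq n 0) x = 0.
Proof. by rewrite /mult nth_nseq if_same. Qed.

Lemma lowest_weight_chain n T : 2 <= n ->
  lowest_weight n T <-> exists2 us, chain (nseq n 0) us & T = tableau_of us.
Proof.
move=> n2; rewrite lowest_weightP //; split=> [[/sdt_tails[us [su ok ->]] h]|[us cu ->]].
  exists us => //; apply/ballot_chain; rewrite ?size_nseq // su => i ni.
  by rewrite !mult_nseq0; apply: h.
have [ok su] := chain_tails cu; rewrite size_nseq in su; rewrite su.
split=> [|i ni]; first exact: tails_sdt.
by have /ballot_chain := cu; rewrite size_nseq => /(_ su ok i ni); rewrite !mult_nseq0.
Qed.

Definition letter_wt (n i : nat) : 'rV[int]_n := (\row_(k < n) (k.+1 == i)%:R)%R.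

Lemma letter_wt_eps n (k : 'I_n) : letter_wt n k.+1 = eps k.
Proof. by apply/rowP => j; rewrite !mxE eqxx eqSS. Qed.

Lemma wt_entry n T (j : 'I_n) :
  wt n T 0%R j =
  ((nb_letter j.+1 T)%:Z - (nb_letter j.+1 (L_tableau n T))%:Z)%R.
Proof.
rewrite /wt summxE (bigD1 j) //= big1 => [|k kj]; rewrite !mxE ?eqxx ?mulr1 ?addr0 //.
by rewrite eq_sym (negbTE kj) andbF mulr0.
Qed.

Lemma L_tableau_cons n r T :
  L_tableau n.+1 (r :: T) = nseq (size r) n.+1 :: L_tableau n T.
Proof.
rewrite /L_tableau /mkseq /= subn0; congr (_ :: _).
by rewrite (iotaDl 1 0) -map_comp.
Qed.

Lemma nb_letter_cons x r T :
  nb_letter x (r :: T) = count_mem x r + nb_letter x T.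
Proof. by rewrite /nb_letter /= count_cat. Qed.

Lemma tails_weight_entry n us (j : 'I_n) :
  tails_weight (letter_wt n) us 0%R j =
  ((nb_letter j.+1 (tableau_of us))%:Z -
   (nb_letter j.+1 (L_tableau (size us) (tableau_of us)))%:Z)%R.
Proof.
elim: us => [|u us IH]; first by rewrite mxE.
have -> : tableau_of (u :: us) =
  (nseq (size (head [::] (tableau_of us))).+1 (size us).+1 ++ u) :: tableau_of us by [].
rewrite L_tableau_cons !nb_letter_cons count_cat !count_nseq size_cat size_nseq.
rewrite [tails_weight _ _]/= mxE IH.
have -> : ((\sum_(x <- u) (letter_wt n x - letter_wt n (size us).+1)) 0 j =
   (count_mem j.+1 u)%:Z - ((j.+1 == (size us).+1) * size u)%:Z)%R.
  rewrite summxE; elim: u => [|x u IHu]; first by rewrite big_nil muln0.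
  rewrite big_cons IHu !mxE /= [j.+1 == x]eq_sym mulnS !PoszD.
  by rewrite !natz opprD addrACA.
rewrite ![pred1 _ _]/= [_ == j.+1]eq_sym mulnDr !PoszD.
rewrite -/(size us).
move: ((_ == _) * _)%N ((_ == _) * _)%N (count_mem _ u) (nb_letter _ _) (nb_letter _ _).
by move=> p q r s t; clear; lia.
Qed.

Lemma wt_tableau_of n us :
  size us = n -> wt n (tableau_of us) = tails_weight (letter_wt n) us.
Proof.
by move=> su; apply/rowP => j; rewrite wt_entry tails_weight_entry su.
Qed.

(** * Subsets of positive roots *)

Section Subsets.
Local Open Scope fset_scope.
Variable V : zmodType.

(** Built along [us] in the same order as [subsums], so that the sums
    correspond. *)
Fixpoint subfsets (us : seq V) : seq {fset V} :=
  if us is u :: us' then subfsets us' ++ [seq u |` B | B <- subfsets us']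
  else [:: fset0].

Lemma mem_subfsets us (B : {fset V}) :
  (B \in subfsets us) = all (fun x => x \in us) B.
Proof.
elim: us B => [|u us IH] B /=.
  rewrite inE; apply/eqP/allP => [-> x|h]; first by rewrite inE.
  by apply/fsetP => x; rewrite inE; apply/negP => /h.
rewrite mem_cat IH; apply/orP/allP => [[/allP h x|/mapP[C CI ->] x]|h].
- by move/h => xu; rewrite inE xu orbT.
- move: CI; rewrite IH => /allP h; rewrite !inE => /orP[->//|/h ->].
  by rewrite orbT.
- have [uB|nuB] := boolP (u \in B); [right|left].
    apply/mapP; exists (B `\ u); last by rewrite fsetD1K.
    rewrite IH; apply/allP => x; rewrite !inE => /andP[ne xB].
    by have := h x xB; rewrite inE (negbTE ne).
  apply/allP => x xB; have := h x xB; rewrite inE => /orP[/eqP ex|//].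
  by rewrite -ex xB in nuB.
Qed.

Lemma notin_subfsets us (u : V) B :
  u \notin us -> B \in subfsets us -> u \notin B.
Proof. by rewrite mem_subfsets => nu /allP h; apply: contra nu => /h. Qed.

Lemma subfsets_uniq us : uniq us -> uniq (subfsets us).
Proof.
elim: us => //= u us IH /andP[nu /IH us_u].
rewrite cat_uniq us_u map_inj_in_uniq ?us_u ?andbT /=.
  apply/hasPn => _ /mapP[C _ ->]; apply/negP => /(notin_subfsets nu).
  by rewrite fset1U1.
move=> B C /(notin_subfsets nu) nB /(notin_subfsets nu) nC eBC.
by rewrite -(fsetU1K nB) -(fsetU1K nC) eBC.
Qed.

Lemma sum_subfsets us (f : V -> nat) : uniq us ->
  \sum_(B <- subfsets us) f (\sum_(b <- B) b)%R = \sum_(s <- subsums us) f s.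
Proof.
elim: us f => [|u us IH] f; first by rewrite !big_seq1 big_seq_fset0.
move=> /= /andP[nu us_u]; rewrite !big_cat !big_map /= IH // -(IH (fun s => f (u + s)%R)) //.
congr (_ + _)%N; rewrite big_seq [RHS]big_seq; apply: eq_bigr => B /(notin_subfsets nu) nB.
by rewrite big_fsetU1.
Qed.
End Subsets.

Lemma letter_wt_inj n i j :
  0 < i <= n -> 0 < j <= n -> letter_wt n i = letter_wt n j -> i = j.
Proof.
case: i j => [|i] [|j] //= lt_i lt_j /(congr1 (fun v : 'rV[int]_n => v 0%R (Ordinal lt_i))).
rewrite !mxE eqxx /= eqSS; case: eqP => [->//|_] /eqP; by rewrite oner_eq0.
Qed.

Lemma mem_shifted_letters n m (t v : 'rV[int]_n) :
  v \in shifted_letters (letter_wt n) m t <->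
  exists2 i, 0 < i <= m & v = (letter_wt n i + t)%R.
Proof.
elim: m => [|m IH]; first by split=> // -[i]; case: i.
rewrite in_cons; split=> [/orP[/eqP->|/IH[i im ->]]|[i im ev]].
- by exists m.+1; rewrite ?leqnn.
- by exists i => //; lia.
have [ei|ne] := eqVneq i m.+1; first by rewrite ev ei eqxx.
by apply/orP; right; apply/IH; exists i => //; move/eqP: ne; lia.
Qed.

Lemma mem_root_list n m (v : 'rV[int]_n) :
  v \in root_list (letter_wt n) m <->
  exists i j, 0 < i < j /\ j <= m /\ v = (letter_wt n i - letter_wt n j)%R.
Proof.
elim: m => [|m IH].
  by split=> // -[i [j [h [jm _]]]]; lia.
rewrite mem_cat; split=> [/orP[/mem_shifted_letters[i im ->]|/IH[i [j [ij [jm ->]]]]]|].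
- by exists i, m.+1; split; [lia|].
- by exists i, j; split=> //; split=> //; lia.
move=> [i [j [ij [jm ev]]]]; apply/orP.
have [ej|ne] := eqVneq j m.+1.
  by left; apply/mem_shifted_letters; exists i; [lia|rewrite ev ej].
by right; apply/IH; exists i, j; split=> //; split=> //; move/eqP: ne; lia.
Qed.

Lemma shifted_letters_uniq n m (t : 'rV[int]_n) :
  m <= n -> uniq (shifted_letters (letter_wt n) m t).
Proof.
elim: m => //= m IH lt_mn; rewrite IH ?(ltnW lt_mn) // andbT.
apply/negP => /mem_shifted_letters[i im /addIr /letter_wt_inj].
by move=> /(_ lt_mn) h; have := h ltac:(lia); lia.
Qed.

Lemma root_list_uniq n m : m <= n -> uniq (root_list (letter_wt n) m).
Proof.
elim: m => //= m IH lt_mn; rewrite cat_uniq shifted_letters_uniq ?(ltnW lt_mn) //=.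
rewrite IH ?(ltnW lt_mn) // andbT; apply/hasPn => v /mem_root_list.
case=> i [j [ij [jm ->]]]; apply/negP => /mem_shifted_letters[k km].
move=> /(congr1 (fun v : 'rV[int]_n => v 0%R (Ordinal lt_mn))); rewrite !mxE /=.
have /negbTE-> : m.+1 != i by apply/eqP; lia.
have /negbTE-> : m.+1 != j by apply/eqP; lia.
have /negbTE-> : m.+1 != k by apply/eqP; lia.
by rewrite eqxx.
Qed.

Lemma mem_Phi_plus n (v : 'rV[int]_n) :
  (v \in Phi_plus n) = (v \in root_list (letter_wt n) n).
Proof.
apply/imfsetP/idP => [[[k l] /= kl ->]|/mem_root_list[i [j [ij [jn ->]]]]].
  by apply/mem_root_list; exists k.+1, l.+1; rewrite !letter_wt_eps; split.
have i0 : i.-1 < n by lia.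
have j0 : j.-1 < n by lia.
exists (Ordinal i0, Ordinal j0) => /=.
  by rewrite unfold_in /=; lia.
by rewrite -!letter_wt_eps /= !prednK //; lia.
Qed.

(** The permutation between the two lists of values lifts to a rearrangement
    of [t], which is then matched with [s] position by position. *)
Lemma perm_map_bij (A B C : eqType) (s : seq A) (t : seq B) (f : A -> C)
    (g : B -> C) (t0 : B) : uniq s -> uniq t -> perm_eq (map f s) (map g t) ->
  exists h : A -> B,
    [/\ {in s, forall x, h x \in t}, {in s &, injective h},
        forall y, y \in t -> exists2 x, x \in s & h x = y &
        {in s, forall x, g (h x) = f x}].
Proof.
move=> us ut pst; have [Is pI eI] := perm_iotaP (g t0) pst.
have pt : perm_eq [seq nth t0 t i | i <- Is] t.
  have := perm_map (nth t0 t) pI; rewrite size_map => /perm_trans; apply.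
  by rewrite -/(mkseq _ _) mkseq_nth.
set t' := [seq _ | i <- Is] in pt.
have eg : map g t' = map f s.
  rewrite eI -map_comp; apply/eq_in_map => i; rewrite (perm_mem pI).
  by rewrite mem_iota size_map /= => it; rewrite (nth_map t0).
have sz : size t' = size s by rewrite -(size_map g) eg size_map.
have ut' : uniq t' by rewrite (perm_uniq pt).
exists (fun x => nth t0 t' (index x s)); split.
- by move=> x xs; rewrite -(perm_mem pt) mem_nth // sz index_mem.
- move=> x y xs ys /eqP; rewrite nth_uniq ?sz ?index_mem // => /eqP e.
  by rewrite -(nth_index x xs) e nth_index.
- move=> y; rewrite -(perm_mem pt) => yt.
  case: s us eg sz {pst eI} => [|x0 s] us eg sz; first by rewrite (size0nil sz) in yt.
  exists (nth x0 (x0 :: s) (index y t')); first by rewrite mem_nth // -sz index_mem.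
  by rewrite index_uniq ?nth_index // -sz index_mem.
- move=> x xs; have := congr1 (fun u => nth (f x) u (index x s)) eg.
  rewrite (nth_map x) ?index_mem // nth_index // => <-.
  by rewrite (nth_map t0) // sz index_mem.
Qed.

(** * The bijection *)

Definition lowest_weights (n : nat) : seq (seq (seq nat)) :=
  [seq tableau_of us | us <- chains n.+2 n (nseq n 0)].

Lemma zero_state_ok n :
  [/\ size (nseq n 0) = n, sorted geq (nseq n 0) &
      head 0 (nseq n 0) + n < n.+2].
Proof.
split; first exact: size_nseq; last by case: n.
by elim: n => [|[|k] IH].
Qed.

Lemma mem_lowest_weights n T : 2 <= n ->
  T \in lowest_weights n <-> lowest_weight n T.
Proof.
move=> n2; have [s0 d0 h0] := zero_state_ok n.
rewrite lowest_weight_chain //; split=> [/mapP[us]|[us cu ->]].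
  by rewrite mem_chains // => cu ->; exists us.
by apply: map_f; rewrite mem_chains.
Qed.

Lemma lowest_weights_uniq n : uniq (lowest_weights n).
Proof.
rewrite map_inj_uniq; last by move=> us vs; exact: tableau_of_inj.
by rewrite chains_uniq ?size_nseq.
Qed.

(** Counting the weights that satisfy a predicate [a], both sides are the
    value of [strip_sum] at the zero state, for [phi] the indicator of [a]. *)
Lemma perm_weights n :
  perm_eq [seq (\sum_(b <- B) b)%R |
             B : {fset 'rV[int]_n} <- subfsets (root_list (letter_wt n) n)]
          [seq wt n T | T <- lowest_weights n].
Proof.
have [s0 d0 h0] := zero_state_ok n.
apply/permP => a; rewrite -!sumn_count !sumnE !big_map.
rewrite (sum_subfsets (fun v => nat_of_bool (a v)) (root_list_uniq (leqnn n))).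
transitivity (strip_sum (letter_wt n) n.+2 (fun v => nat_of_bool (a v)) n (nseq n 0) 0%R).
  by rewrite strip_sum_zero //; apply: eq_bigr => s _; rewrite add0r.
rewrite -sum_chains //; apply: eq_big_seq => us; rewrite mem_chains // => cu.
have [ok su] := chain_tails cu.
rewrite add0r (state_weight_letters _ cu) big1 ?add0r => [|x _]; last first.
  by rewrite mult_nseq0 mulr0n.
by rewrite wt_tableau_of // -su.
Qed.

Local Open Scope ring_scope.

Theorem proposition3p18 (n : nat) (hn : (2 <= n)%N) :
  exists Xi : {fset 'rV[int]_n} -> seq (seq nat),
    set_bij [set B : {fset 'rV[int]_n} | (B `<=` Phi_plus n)%fset]%classic
            (lowest_weight n) Xi /\
    (forall B : {fset 'rV[int]_n}, (B `<=` Phi_plus n)%fset ->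
       wt n (Xi B) = \sum_(beta <- B) beta).
Proof.
have rootsP (B : {fset 'rV[int]_n}) :
    (B \in subfsets (root_list (letter_wt n) n)) = (B `<=` Phi_plus n)%fset.
  by rewrite mem_subfsets; apply/allP/fsubsetP => h x /h; rewrite mem_Phi_plus.
have [Xi [XiP Xi_inj Xi_surj XiE]] := perm_map_bij [::]
  (subfsets_uniq (root_list_uniq (leqnn n))) (lowest_weights_uniq n)
  (perm_weights n).
exists Xi; split=> [|B]; last by rewrite -rootsP => /XiE.
split=> [B /=|B C|T /(mem_lowest_weights _ hn) /Xi_surj[B]].
- by rewrite -rootsP => /XiP /(mem_lowest_weights _ hn).
- by rewrite !inE /= -!rootsP; exact: Xi_inj.
- by rewrite rootsP => BP <-; exists B.
Qed.
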